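(* Let $\mathbf{x}=x_1,\ldots,x_n$ and $\mathbf{u}=u_1,\ldots,u_m$ be differential indeterminates over $\mathbb{C}$, and let $\mathbf{f}=f_1,\ldots,f_n$ and $\mathbf{g}=g_1,\ldots,g_s$ be polynomials in $\mathbb{C}[\mathbf{x},\mathbf{u}]$. Let $V\subset\mathbb{C}^{n+m}$ be the (nonempty) variety of common zeros of the ideal $(\mathbf{g})$, let $r:=\dim(V)\ge 0$, $\nu:=\max\{1,r\}$, and let $D$ be an upper bound for the degrees of $\mathbf{f}$, of $\mathbf{g}$ and of $V$. Then $$1\in[\dot{\mathbf{x}}-\mathbf{f},\mathbf{g}]\quad\Longleftrightarrow\quad 1\in(\dot{\mathbf{x}}-\mathbf{f},\ldots,\mathbf{x}^{(L+1)}-\mathbf{f}^{(L)},\mathbf{g},\ldots,\mathbf{g}^{(L)}),$$ where $L\le((n+m)D)^{2^{c\nu^2(n+m)}}$ for a universal constant $c>0$.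
   Context: $\mathbb{C}\{\mathbf{x},\mathbf{u}\}$ is the differential polynomial ring $\mathbb{C}[x_j^{(p)},u_k^{(p)}: p\in\mathbb{N}_0]$ with derivation $x_j^{(p)}\mapsto x_j^{(p+1)}$, $u_k^{(p)}\mapsto u_k^{(p+1)}$ and $\mathbb{C}$ as constants; $\dot z=z^{(1)}$, $h^{(p)}$ is the $p$-th total derivative of $h$, and for a family $\mathbf{h}$, $\mathbf{h}^{(p)}$ is the family of $p$-th derivatives. $[\cdot]$ denotes the differential ideal generated, and $(\cdot)$ the ordinary polynomial ideal in the polynomial ring in the finitely many variables involved. The degree of an irreducible affine variety is the number of points of its intersection with a generic affine linear subspace of complementary dimension; the degree of an arbitrary variety is the sum of the degrees of its irreducible components. *)

(* Defs.v *)
From HB Require Import structures.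
From mathcomp Require Import all_boot all_algebra finmap.
From mathcomp.multinomials Require Import monalg.
From mathcomp Require Import complex Rstruct.
From Stdlib Require Reals.

Set Implicit Arguments.
Unset Strict Implicit.
Unset Printing Implicit Defensive.

Import GRing.Theory.
Local Open Scope ring_scope.

Notation RR := Rdefinitions.R.
Notation CC := (complex Rdefinitions.R).

Notation poly_in I := {malg CC[{cmonom I}]}.

Definition pvar (I : choiceType) (v : I) : poly_in I := << ucm v >>.

Definition peval (I : choiceType) (z : I -> CC) (p : poly_in I) : CC :=
  \sum_(k <- msupp p) p@_k * \prod_(i <- finsupp k) z i ^+ k i.

(* Ordinary polynomials C[x,u] = C[x_1..x_n,u_1..u_m]: variables 'I_(n+m)
   (index lshift m i is x_i, index rshift n k is u_k).                  *)
Notation OPoly N := (poly_in 'I_N).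

(* Differential polynomial ring C{x,u}: variable (i, p) is the p-th
   derivative of the i-th indeterminate (x_1..x_n, u_1..u_m).           *)
Definition dvar (N : nat) := ('I_N * nat)%type.
Notation DPoly N := (poly_in (dvar N)).

Definition embed0 (N : nat) (p : OPoly N) : DPoly N :=
  \sum_(k <- msupp p) p@_k *: \prod_(i <- finsupp k) pvar ((i, 0%N) : dvar N) ^+ k i.

(* d is the derivation of C{x,u}: additive, Leibniz, C as constants,
   z^(p) |-> z^(p+1) (this determines d uniquely). *)
Definition total_derivation (N : nat) (d : DPoly N -> DPoly N) : Prop :=
  [/\ (forall a b, d (a + b) = d a + d b),
      (forall a b, d (a * b) = d a * b + a * d b),
      (forall c : CC, d c%:MP = 0) &
      (forall (i : 'I_N) (p : nat), d (pvar ((i, p) : dvar N)) = pvar ((i, p.+1) : dvar N))].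

Definition is_ideal (R : comNzRingType) (I : R -> Prop) : Prop :=
  [/\ I 0, (forall x y, I x -> I y -> I (x + y)) & (forall r x, I x -> I (r * x))].

Definition in_ideal (R : comNzRingType) (S : seq R) (p : R) : Prop :=
  exists cs : seq R, size cs = size S /\ p = \sum_(i < size S) cs`_i * S`_i.

Definition in_diff_ideal (R : comNzRingType) (d : R -> R) (S : seq R) (p : R) : Prop :=
  forall I : R -> Prop, is_ideal I -> (forall x, I x -> I (d x)) ->
    (forall s, s \in S -> I s) -> I p.

Definition sys_gens (n m s : nat) (f : 'I_n -> OPoly (n + m)) (g : 'I_s -> OPoly (n + m))
  : seq (DPoly (n + m)) :=
  [seq pvar ((lshift m i, 1%N) : dvar (n + m)) - embed0 (f i) | i <- enum 'I_n]
  ++ [seq embed0 (g j) | j <- enum 'I_s].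

Definition trunc_gens (n m s : nat) (d : DPoly (n + m) -> DPoly (n + m))
  (f : 'I_n -> OPoly (n + m)) (g : 'I_s -> OPoly (n + m)) (L : nat)
  : seq (DPoly (n + m)) :=
  [seq pvar ((lshift m i, k.+1) : dvar (n + m)) - iter k d (embed0 (f i))
     | k <- iota 0 L.+1, i <- enum 'I_n]
  ++ [seq iter k d (embed0 (g j)) | k <- iota 0 L.+1, j <- enum 'I_s].

Definition pt (N : nat) := {ffun 'I_N -> CC}.
Definition vset (N : nat) := pt N -> Prop.

Definition subset N (A B : vset N) : Prop := forall z, A z -> B z.
Definition psubset N (A B : vset N) : Prop := subset A B /\ exists z, B z /\ ~ A z.
Definition same_set N (A B : vset N) : Prop := forall z, A z <-> B z.

Definition zero_set N (P : OPoly N -> Prop) : vset N :=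
  fun z => forall p, P p -> peval (fun i => z i) p = 0.
Definition zclosed N (W : vset N) : Prop := exists P, same_set W (zero_set P).

Definition vzeros N s (g : 'I_s -> OPoly N) : vset N :=
  fun z => forall j, peval (fun i => z i) (g j) = 0.

Definition irreducible N (W : vset N) : Prop :=
  [/\ zclosed W, (exists z, W z) &
      forall A B, zclosed A -> zclosed B -> subset W (fun z => A z \/ B z) ->
        subset W A \/ subset W B].

Definition irr_chain N (V : vset N) (W : nat -> vset N) (k : nat) : Prop :=
  (forall i, (i <= k)%N -> irreducible (W i) /\ subset (W i) V) /\
  (forall i, (i < k)%N -> psubset (W i) (W i.+1)).
Definition dim_is N (V : vset N) (r : nat) : Prop :=
  (exists W, irr_chain V W r) /\ ~ (exists W, irr_chain V W r.+1).

Definition param_var (d N : nat) := ('I_d * 'I_N + 'I_d)%type.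
Definition param_pt d N (M : 'M[CC]_(d, N)) (b : 'cV[CC]_d) : param_var d N -> CC :=
  fun v => match v with inl (i, j) => M i j | inr i => b i 0 end.
Definition aff_sub d N (M : 'M[CC]_(d, N)) (b : 'cV[CC]_d) : vset N :=
  fun z => forall i : 'I_d, \sum_(j < N) M i j * z j = b i 0.

(* Degree of an irreducible variety W of dimension dW: the number delta of
   points of W /\ A for a generic affine subspace A of complementary
   dimension, i.e. for all (M, b) outside a proper Zariski-closed subset
   (the zero set of a nonzero polynomial h) of the parameter space. *)
Definition irr_deg_is N (W : vset N) (dW delta : nat) : Prop :=
  exists h : poly_in (param_var dW N), h != 0 /\
    forall M b, peval (param_pt M b) h != 0 ->
      exists pts : seq (pt N), [/\ uniq pts, size pts = delta &
        forall z, (W z /\ aff_sub M b z) <-> z \in pts].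

Definition irr_component N (V W : vset N) : Prop :=
  [/\ irreducible W, subset W V &
      forall W', irreducible W' -> subset W W' -> subset W' V -> subset W' W].

Definition deg_is N (V : vset N) (delta : nat) : Prop :=
  exists (k : nat) (W : nat -> vset N) (dims degs : nat -> nat),
    [/\ (forall i, (i < k)%N ->
           [/\ irr_component V (W i), dim_is (W i) (dims i) & irr_deg_is (W i) (dims i) (degs i)]),
        (forall i j, (i < k)%N -> (j < k)%N -> same_set (W i) (W j) -> i = j),
        (forall W', irr_component V W' -> exists2 i, (i < k)%N & same_set W' (W i)) &
        delta = (\sum_(i < k) degs i)%N].

(* Real power x^y for x >= 0 (with 0^y := 0, only used with y > 0). *)
Definition rpow (x y : RR) : RR :=
  if RIneq.Rle_dec x (Rdefinitions.R0) then Rdefinitions.R0 else Rpower.Rpower x y.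

Definition bound (c : RR) (n m D r : nat) : RR :=
  rpow (Raxioms.INR ((n + m) * D))
       (Rpower.Rpower (Rdefinitions.Rplus Rdefinitions.R1 Rdefinitions.R1)
          (Rdefinitions.Rmult c (Raxioms.INR ((maxn 1 r) ^ 2 * (n + m))))).

(* Main.v *)
Require Import Defs.
From HB Require Import structures.
From mathcomp Require Import all_boot all_algebra finmap.
From mathcomp.multinomials Require Import monalg.
From mathcomp Require Import complex Rstruct.
From Stdlib Require Reals.
From mathcomp.multinomials Require mpoly.
From mathcomp Require boolp classical_sets.
From mathcomp Require Import zify ring.

(* If 1 is not in the truncated ideal, that ideal vanishes at a point over some field [k] of
   characteristic 0, and Taylor expansion turns the point into a jet: polynomials [z] over [k]
   which satisfy the system modulo [t^K], where [K = L + 1].  It remains to produce, for [K]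
   large, a nonzero differential ring in which the system has a genuine solution.

   By counting monomials there is a gap: some [A] with [2A <= K] such that no polynomial of
   bounded degree in [z] has [t]-order in [A, 2A).  Consequently "zero modulo [t^2A]" behaves
   like a prime ideal in bounded degree.  By pigeonhole over a tower of [N + 1] degree bounds
   (each polynomial in the previous one), there are linear forms [w] in [z] that are
   algebraically independent modulo [t^2A] in degree at most [2 E^2], while any further form [T]
   is tied to them by a prime relation [q (w, T) = 0] of a much smaller degree [e].  By
   resultants, [q] divides every polynomial of degree at most [E] vanishing at [(w, T)].  Choosing
   [T] so that [q] has maximal degree in [T], and differentiating the relations of [T + x z_j] at
   [x = 0], writes [h z_j = rho_j (w, T)] with [q] not dividing [h]: the jet is a truncated point
   of the hypersurface [q = 0].

   The derivatives of [(w, T)] then solve a linear system which says that a vector field is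
   tangent to [q = 0] and induces the prescribed derivatives of [rho_j / h].  Its solvability
   modulo [q] up to a denominator [b] is governed by bordered minors, which have degree at most
   [E] and vanish along the jet, hence are divisible by [q].  The resulting vector field makes
   [k[w, T][1 / (h b)] / (q)] the required differential ring. *)

Set Implicit Arguments.
Unset Strict Implicit.
Unset Printing Implicit Defensive.
Import GRing.Theory.
Local Open Scope ring_scope.

(** * Unique factorisation and elimination *)

Definition rdvd (R : comNzRingType) (a b : R) := exists c, b = c * a.

Definition rprime (R : comNzRingType) (q : R) :=
  [/\ q != 0, ~ rdvd q 1 & forall a b, rdvd q (a * b) -> rdvd q a \/ rdvd q b].

(** The unit [u] comes with its inverse [v], so that the notion makes sense in any commutative
    ring. *)
Definition ufactored (R : comNzRingType) (a : R) :=
  exists u v : R, exists ps : seq R,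
    [/\ u * v = 1, forall p, p \in ps -> rprime p & a = u * \prod_(p <- ps) p].

Definition ufd (R : comNzRingType) := forall a : R, a != 0 -> ufactored a.

Section Divisibility.
Variable R : comNzRingType.
Implicit Types a b c : R.

Lemma rdvdxx a : rdvd a a. Proof. by exists 1; rewrite mul1r. Qed.

Lemma rdvd0 a : rdvd a 0. Proof. by exists 0; rewrite mul0r. Qed.

Lemma rdvd_mull a b c : rdvd a b -> rdvd a (c * b).
Proof. by move=> [x ->]; exists (c * x); rewrite mulrA. Qed.

Lemma rdvd_mulr a b c : rdvd a b -> rdvd a (b * c).
Proof. by rewrite mulrC; apply: rdvd_mull. Qed.

Lemma rdvdD a b c : rdvd a b -> rdvd a c -> rdvd a (b + c).
Proof. by move=> [x ->] [y ->]; exists (x + y); rewrite mulrDl. Qed.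

Lemma rdvdN a b : rdvd a b -> rdvd a (- b).
Proof. by move=> [x ->]; exists (- x); rewrite mulNr. Qed.

Lemma rdvdB a b c : rdvd a b -> rdvd a c -> rdvd a (b - c).
Proof. by move=> hb /rdvdN; apply: rdvdD. Qed.

Lemma rdvd_prime_prod q (I : Type) (r : seq I) (P : pred I) (F : I -> R) :
  rprime q -> rdvd q (\prod_(i <- r | P i) F i) -> exists2 i, P i & rdvd q (F i).
Proof.
move=> [_ q1 qp]; elim: r => [|i r IH]; first by rewrite big_nil.
rewrite big_cons; case: ifP => Pi // /qp[|//]; by exists i.
Qed.

Lemma rdvd_prime_exp q a k : rprime q -> rdvd q (a ^+ k) -> rdvd q a.
Proof.
move=> [_ q1 qp]; elim: k => [|k IH]; first by rewrite expr0.
by rewrite exprS => /qp[].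
Qed.

End Divisibility.

Section UfdPoly.
Variable R : idomainType.
Implicit Types (p c : R) (f g h q : {poly R}).

Lemma rdvd_polyC p f : rdvd p%:P f <-> forall i, rdvd p f`_i.
Proof.
split=> [[g -> i]|]; first by exists g`_i; rewrite coefMC.
elim/poly_ind: f => [_|f c IH h]; first exact: rdvd0.
have hc : rdvd p c by move: (h 0%N); rewrite coefD coefMX coefC /= add0r.
have [i|g ->] := IH; first by move: (h i.+1); rewrite coefD coefMX coefC addr0.
by case: hc => d ->; exists (g * 'X + d%:P); rewrite mulrDl polyCM mulrAC.
Qed.

Lemma rdvd_polyC_MX p f : rdvd p%:P (f * 'X) -> rdvd p%:P f.
Proof.
move=> /rdvd_polyC h; apply/rdvd_polyC => i.
by move: (h i.+1); rewrite coefMX.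
Qed.

(** Gauss's lemma, by induction on the total size: [p] divides the product of the constant terms,
    hence one of them, and that term can be stripped off its factor. *)
Lemma rprime_polyC p : rprime p -> rprime p%:P.
Proof.
move=> [p0 p1 pp]; split; first by rewrite polyC_eq0.
  move/rdvd_polyC => /(_ 0%N); by rewrite coef1.
have main n : forall f g, (size f + size g <= n)%N ->
    rdvd p%:P (f * g) -> rdvd p%:P f \/ rdvd p%:P g.
  elim: n => [|n IH] f g.
    rewrite leqn0 addn_eq0 => /andP[/eqP/size0nil hf _] _; left.
    have -> : f = 0 by apply/eqP; rewrite -size_poly_eq0 hf.
    exact: rdvd0.
  (* Exchanging the factors if necessary, the constant term divisible by [p] is that of [f]. *)
  wlog hab : f g / rdvd p f`_0.
    move=> W sz H; have : rdvd p (f`_0 * g`_0).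
      by move/rdvd_polyC: (H) => /(_ 0%N); rewrite coef0M.
    case/pp => h0; first exact: W.
    have [] := W g f h0 _ _; rewrite 1?addnC 1?mulrC //; first by right.
    by left.
  elim/poly_ind: f hab => [|f c _] hc sz H; first by left; apply: rdvd0.
  move: hc; rewrite coefD coefMX coefC /= add0r => hc.
  have hcP : rdvd p%:P c%:P by case: hc => d ->; exists d%:P; rewrite polyCM.
  have [f0|f0] := eqVneq f 0.
    by left; rewrite f0 mul0r add0r.
  have Hf : rdvd p%:P (f * g).
    apply: rdvd_polyC_MX; rewrite mulrAC.
    have -> : f * 'X * g = (f * 'X + c%:P) * g - c%:P * g by ring.
    by apply: rdvdB => //; apply: rdvd_mulr.
  case: (IH f g) => //.
  - by move: sz; rewrite size_MXaddC (negPf f0) /= addSn ltnS.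
  - by move=> h; left; apply: rdvdD => //; apply: rdvd_mulr.
  - by right.
by move=> f g; apply: (main _ _ _ (leqnn _)).
Qed.

(** By Gauss's lemma each prime of [c] divides [h1] or [h2] and can be cancelled there without
    changing degrees. A factorisation over the fraction field thus descends to [R]. *)
Lemma gauss_factor c q h1 h2 : ufactored c -> c%:P * q = h1 * h2 ->
  exists g1 g2, [/\ q = g1 * g2, size g1 = size h1 & size g2 = size h2].
Proof.
case=> u [v [ps [uv psP ->]]].
elim: ps psP h1 h2 => [|p ps IH] psP h1 h2.
  rewrite big_nil mulr1 => E; exists (v%:P * h1), h2; split=> //.
    by rewrite -mulrA -E mulrA -polyCM mulrC -[v * u]mulrC uv mulr1.
  rewrite mul_polyC size_scale //; apply: contra_eq_neq uv => ->.
  by rewrite mulr0 eq_sym oner_neq0.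
rewrite big_cons => E.
have pP : rprime p by apply: psP; rewrite mem_head.
have [p0 _ _] := pP; have [_ _ hp] := rprime_polyC pP.
have /hp : rdvd p%:P (h1 * h2).
  by rewrite -E; exists ((u * \prod_(j <- ps) j)%:P * q); rewrite !polyCM; ring.
have psP' r : r \in ps -> rprime r by move=> H; apply: psP; rewrite inE H orbT.
have pP0 : p%:P != 0 by rewrite polyC_eq0.
case=> -[g eg].
  have [|g1 [g2 [-> s1 s2]]] := IH psP' g h2.
    apply: (mulfI pP0); rewrite mulrA -polyCM mulrCA E eg; ring.
  by exists g1, g2; split=> //; rewrite s1 eg mulrC mul_polyC size_scale.
have [|g1 [g2 [-> s1 s2]]] := IH psP' h1 g.
  apply: (mulfI pP0); rewrite mulrA -polyCM mulrCA E eg; ring.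
by exists g1, g2; split=> //; rewrite s2 eg mulrC mul_polyC size_scale.
Qed.

Lemma primitive_rdvd q : (forall p, rprime p -> ~ rdvd p%:P q) ->
  forall c f, ufactored c -> rdvd q (c%:P * f) -> rdvd q f.
Proof.
move=> qprim c f [u [v [ps [uv psP ->]]]].
elim: ps psP => [|p ps IH] psP [e].
  rewrite big_nil mulr1 => E; exists (v%:P * e).
  by rewrite -mulrA -E mulrA -polyCM mulrC -[v * u]mulrC uv mulr1.
rewrite big_cons => E.
have pP : rprime p by apply: psP; rewrite mem_head.
have [p0 _ _] := pP; have [_ _ hp] := rprime_polyC pP.
have /hp[[g eg]|/(qprim _ pP) //] : rdvd p%:P (e * q).
  by rewrite -E; exists ((u * \prod_(j <- ps) j)%:P * f); rewrite !polyCM; ring.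
apply: IH; first by move=> r H; apply: psP; rewrite inE H orbT.
have pP0 : p%:P != 0 by rewrite polyC_eq0.
by exists g; apply: (mulfI pP0); rewrite mulrA -polyCM mulrCA E eg; ring.
Qed.

(** The prime [p] divides some member of [ps] and is associated to it; the unit relating them is
    absorbed into [u]. The drop in the number of primes drives the inner induction of [ufd_poly]. *)
Lemma ufactored_cancel p c : rprime p -> forall u v ps,
  u * v = 1 -> (forall r, r \in ps -> rprime r) ->
  c * p = u * \prod_(r <- ps) r ->
  exists u' v' ps', [/\ u' * v' = 1, forall r, r \in ps' -> rprime r,
    c = u' * \prod_(r <- ps') r & size ps = (size ps').+1].
Proof.
move=> pP u v ps uv psP E.
have [p0 p1 pp] := pP.
have : rdvd p (u * \prod_(r <- ps) r) by rewrite -E; apply: rdvd_mull (rdvdxx _).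
case/pp => [[w uw]|]; first by case: p1; exists (w * v); rewrite mulrAC -uw.
rewrite (big_nth 0) big_mkord => /(rdvd_prime_prod pP)[i _ [d ed]].
have rP : rprime ps`_i by apply: psP; rewrite mem_nth.
have [r0 r1 rr] := rP.
have : rdvd ps`_i (d * p) by rewrite -ed; apply: rdvdxx.
case/rr => -[e ee].
  case: p1; exists e; apply: (mulfI r0); rewrite mulr1 {1}ed ee; ring.
have ed1 : d * e = 1.
  by apply: (mulfI r0); rewrite mulr1 {2}ed ee; ring.
have iS : ps`_i \in ps by rewrite mem_nth.
exists (u * d), (v * e), (rem ps`_i ps); split.
- by rewrite mulrACA uv ed1 mulr1.
- by move=> r /mem_rem; apply: psP.
- apply: (mulIf p0); rewrite E (big_rem _ iS) /= {1}ed; ring.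
- by rewrite size_rem // prednK // (leq_ltn_trans (leq0n i) (ltn_ord i)).
Qed.

Lemma ufactored_mul (S : comNzRingType) (a b : S) :
  ufactored a -> ufactored b -> ufactored (a * b).
Proof.
move=> [u [v [ps [uv hp ->]]]] [u' [v' [ps' [uv' hp' ->]]]].
exists (u * u'), (v * v'), (ps ++ ps'); split.
- by rewrite mulrACA uv uv' mulr1.
- by move=> r; rewrite mem_cat => /orP[/hp|/hp'].
- by rewrite big_cat /= mulrACA.
Qed.

Lemma ufactored_prime (S : comNzRingType) (p : S) : rprime p -> ufactored p.
Proof.
move=> hp; exists 1, 1, [:: p]; rewrite mul1r big_seq1 mul1r; split=> // r.
by rewrite inE => /eqP->.
Qed.

Lemma ufactored_polyC c : ufactored c -> ufactored c%:P.
Proof.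
move=> [u [v [ps [uv hp ->]]]]; exists u%:P, v%:P, (map polyC ps); split.
- by rewrite -polyCM uv.
- by move=> r /mapP[p /hp pP ->]; apply: rprime_polyC.
- by rewrite polyCM rmorph_prod big_map.
Qed.

(* A primitive polynomial with no factorisation over the fraction field is
   prime: pseudo-division handles the fraction field, primitivity clears
   the denominators. *)
Lemma rprime_irreducible q : ufd R -> (1 < size q)%N ->
  (forall p, rprime p -> ~ rdvd p%:P q) ->
  (forall c h1 h2, c != 0 -> c%:P * q = h1 * h2 ->
     (size h1 <= 1)%N \/ (size h2 <= 1)%N) ->
  rprime q.
Proof.
move=> UR sq qprim qirr; have q0 : q != 0 by rewrite -size_poly_gt0 (ltn_trans _ sq).
have toR x : q %| x -> rdvd q x.
  case/Pdiv.Idomain.dvdpP => -[c e] /= c0 E.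
  apply: (primitive_rdvd qprim (UR c c0)); exists e; rewrite mul_polyC; exact: E.
split=> //.
  case=> c E; have := congr1 (fun f : {poly R} => size f) E.
  have c0 : c != 0 by apply: contra_eq_neq E => ->; rewrite mul0r oner_neq0.
  rewrite size_poly1 size_mul //; move: sq c0; rewrite -size_poly_gt0.
  case: (size c) (size q) => [|a] [|[|b]] //=. by rewrite addnS addnS.
move=> a b [w E].
have /Pdiv.Idomain.dvdpP[[c h] /= c0 Eg] := Pdiv.Idomain.dvdp_gcdl q a.
have qab : q %| a * b by rewrite E Pdiv.Idomain.dvdp_mull.
case: (qirr c h (gcdp q a) c0); first by rewrite mul_polyC.
  move=> hs; left; apply: toR.
  apply: (Pdiv.Idomain.dvdp_trans _ (Pdiv.Idomain.dvdp_gcdr q a)).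
  have h0 : h`_0 != 0.
    rewrite -polyC_eq0 -(size1_polyC hs); apply: contraNneq q0 => h0.
    by move: Eg; rewrite h0 mul0r => /eqP; rewrite scale_poly_eq0 (negPf c0).
  rewrite -(Pdiv.Idomain.dvdpZl _ _ c0) Eg (size1_polyC hs) mul_polyC.
  by rewrite Pdiv.Idomain.dvdpZl.
move=> gs; right; apply: toR.
have cop : coprimep q a.
  rewrite /coprimep eqn_leq gs size_poly_gt0 Pdiv.Idomain.gcdp_eq0.
  by rewrite negb_and q0.
by rewrite -(Pdiv.Idomain.Gauss_dvdpr _ cop).
Qed.

(** Outer induction on the size of [q], inner induction on the number of primes in its leading
    coefficient. A constant prime divisor lowers the second measure, and a factorisation over the
    fraction field lowers the first. When neither exists, [rprime_irreducible] applies. *)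
Theorem ufd_poly : ufd R -> ufd {poly R}.
Proof.
move=> UR q; move: {2}(size q) (leqnn (size q)) => n.
elim: n q => [|n IHn] q; first by rewrite leqn0 size_poly_eq0 => ->.
move=> sq q0; have lq0 : lead_coef q != 0 by rewrite lead_coef_eq0.
have [u [v [ps [uv psP E]]]] := UR _ lq0.
move: {2}(size ps) (leqnn (size ps)) => m.
elim: m q sq q0 lq0 u v ps uv psP E => [|m IHm] q sq q0 lq0 u v ps uv psP E sm.
all: have [sq1|sq1] := leqP (size q) 1;
  first by rewrite (size1_polyC sq1); apply/ufactored_polyC/UR;
           rewrite -polyC_eq0 -(size1_polyC sq1).
all: have [[p [pP [q' Eq]]]|qprim] :=
  boolp.EM (exists p, rprime p /\ rdvd p%:P q).
1,3: have p0 : p != 0 by [case: pP].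
1,2: have lE : lead_coef q = lead_coef q' * p by
   rewrite Eq lead_coefM lead_coefC.
1,2: have [u' [v' [ps' [uv' psP' E' ss]]]] :=
  ufactored_cancel pP uv psP (etrans (esym lE) E).
- by rewrite ss in sm.
- rewrite Eq; apply: ufactored_mul; last exact/ufactored_polyC/ufactored_prime.
  have q'0 : q' != 0 by apply: contraNneq q0 => q'0; rewrite Eq q'0 mul0r.
  apply: (IHm q' _ q'0 _ u' v' ps') => //; rewrite ?lead_coef_eq0 //.
    by move: sq; rewrite Eq mulrC mul_polyC size_scale.
  by rewrite -ltnS -ss.
all: have [[c [h1 [h2 [c0 Ec s1 s2]]]]|qirr] := boolp.EM (exists c h1 h2,
  [/\ c != 0, c%:P * q = h1 * h2, (1 < size h1)%N & (1 < size h2)%N]).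
1,3: have [g1 [g2 [Eq e1 e2]]] := gauss_factor (UR _ c0) Ec.
1,2: have [g10 g20] : g1 != 0 /\ g2 != 0 by
  rewrite -!size_poly_gt0 e1 e2 !(ltn_trans _ s1) // (ltn_trans _ s2).
1,2: rewrite Eq; apply: ufactored_mul; apply: IHn => //;
  move: sq; rewrite Eq size_mul // e1 e2; move: s1 s2; clear; lia.
all: apply/ufactored_prime/rprime_irreducible => // [p pP hp|c h1 h2 c0 Ec];
  first by apply: qprim; exists p.
all: have [|s1] := leqP (size h1) 1; [by left|right]; rewrite leqNgt;
  apply/negP => s2; apply: qirr; exists c, h1, h2; by split.
Qed.

End UfdPoly.

Section Elimination.
Variable R : idomainType.
Implicit Types p q : {poly R}.

(* A common factor over the fraction field would be divisible by [q]. *)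
Lemma resultant_prime_neq0 q p : rprime q -> (1 < size q)%N -> ~ rdvd q p ->
  resultant q p != 0.
Proof.
move=> qP sq ndvd; rewrite resultant_eq0; apply/negP => hg.
have [q0 q1 qq] := qP.
have /Pdiv.Idomain.dvdpP[[c h] /= c0 E] := Pdiv.Idomain.dvdp_gcdl q p.
set g := gcdp _ _ in hg E.
have ndvdC x : x != 0 -> ~ rdvd q x%:P.
  move=> x0 [y Ey]; have := congr1 (fun f : {poly _} => size f) Ey.
  have y0 : y != 0.
    by apply: contra_eq_neq Ey => ->; rewrite mul0r polyC_eq0.
  rewrite size_polyC x0 size_mul //; move: sq y0; rewrite -size_poly_gt0.
  by case: (size y) (size q) => [|a] [|[|b]] //=; rewrite addnS addnS.
have : rdvd q (h * g) by exists c%:P; rewrite -E mul_polyC.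
case/qq => [[y Ey]|qg].
  have gy : g * y = c%:P.
    by apply: (mulIf q0); rewrite mul_polyC E Ey; ring.
  have := congr1 (fun f : {poly _} => size f) gy.
  have [g0 y0] : g != 0 /\ y != 0.
    by split; apply: contra_eq_neq gy => ->; rewrite ?mul0r ?mulr0 eq_sym polyC_eq0.
  rewrite size_polyC c0 size_mul //; move: hg y0; rewrite -size_poly_gt0.
  by case: (size y) (size g) => [|a] [|[|b]] //=; rewrite addSn addnS.
have /Pdiv.Idomain.dvdpP[[c' h'] /= c'0 E'] := Pdiv.Idomain.dvdp_gcdr q p.
have : rdvd q (c'%:P * p).
  by rewrite mul_polyC E'; apply: rdvd_mull.
by case/qq => [|//]; apply: ndvdC.
Qed.

Lemma resultant_morph (S : nzRingType) (f : {rmorphism {poly R} -> S}) q p :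
  (1 < size q)%N -> (1 < size p)%N ->
  exists a b, f (resultant q p)%:P = a * f q + b * f p.
Proof.
move=> sq sp; have [[a b] /= _ E] := resultant_in_ideal sq sp.
by exists (f a), (f b); rewrite E rmorphD !rmorphM.
Qed.

End Elimination.

Lemma rdvd_size (R : idomainType) (p q : {poly R}) :
  q != 0 -> rdvd p q -> (size p <= size q)%N.
Proof.
move=> + [c E]; rewrite E mulf_eq0 negb_or => /andP[c0 p0].
rewrite size_mul //; move: c0; rewrite -size_poly_gt0.
by case: (size c) => // n _; rewrite addSn leq_addl.
Qed.

Lemma deriv_neq0 (R : idomainType) (p : {poly R}) :
  (forall n, n.+1%:R != 0 :> R) -> (1 < size p)%N -> p^`() != 0.
Proof.
move=> ch0 sp; apply/eqP => E; have := congr1 (fun f : {poly R} => f`_(size p).-2) E.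
rewrite coef_deriv coef0 (_ : (size p).-2.+1 = (size p).-1); last by case: (size p) sp => [|[]].
move/eqP; rewrite -mulr_natr mulf_eq0 -lead_coefE lead_coef_eq0.
rewrite -size_poly_eq0; case: (size p) sp => [|[|n]] //= _.
by rewrite (negPf (ch0 n)).
Qed.

(** * Degree bounds, factorisation and elimination in several variables *)

Module MPolyFacts. Import mpoly.
Notation "{ 'mpoly' T [ n ] }" := (mpoly n T) : type_scope.

Lemma mpoly_morph_eq (n : nat) (R : comNzRingType) (S : nzRingType)
    (f g : {rmorphism {mpoly R[n]} -> S}) :
  (forall c, f c%:MP = g c%:MP) -> (forall i, f 'X_i = g 'X_i) -> f =1 g.
Proof.
move=> hC hX p; rewrite (mpolyE p) !rmorph_sum; apply: eq_bigr => m _.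
rewrite -mul_mpolyC !rmorphM hC; congr (_ * _).
rewrite mpolyXE_id !rmorph_prod; apply: eq_bigr => i _.
by rewrite !rmorphXn /= hX.
Qed.

Section Degree.
Variables (n : nat) (k : fieldType).
Implicit Types (p q : {mpoly k[n]}) (e : nat).

(** [msize] is the total degree plus one, and 0 for the zero polynomial, which therefore satisfies
    every bound. *)
Definition dle e p := (msize p <= e.+1)%N.

Lemma dle_le e e' p : (e <= e')%N -> dle e p -> dle e' p.
Proof. by move=> le h; apply: leq_trans h _. Qed.

Lemma dle0 e : dle e 0. Proof. by rewrite /dle msize0. Qed.

Lemma dleC e c : dle e c%:MP.
Proof. by rewrite /dle msizeC; case: eqP. Qed.

Lemma dle1 e : dle e 1. Proof. exact: dleC. Qed.

Lemma dleX e i : (0 < e)%N -> dle e 'X_i.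
Proof. by rewrite /dle msizeX mdeg1. Qed.

Lemma dleD e p q : dle e p -> dle e q -> dle e (p + q).
Proof.
by move=> hp hq; apply: leq_trans (msizeD_le _ _) _; rewrite geq_max; apply/andP.
Qed.

Lemma dleN e p : dle e p -> dle e (- p).
Proof. by rewrite /dle msizeN. Qed.

Lemma dleB e p q : dle e p -> dle e q -> dle e (p - q).
Proof. by move=> hp hq; apply: dleD => //; apply: dleN. Qed.

Lemma dleM e f p q : dle e p -> dle f q -> dle (e + f) (p * q).
Proof.
rewrite /dle => hp hq; have [->|p0] := eqVneq p 0; first by rewrite mul0r msize0.
have [->|q0] := eqVneq q 0; first by rewrite mulr0 msize0.
rewrite msizeM //; apply: (@leq_trans (e.+1 + f.+1).-1); last by lia.
by rewrite -!subn1; apply/leq_sub2r/leq_add.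
Qed.

Lemma dleZ e c p : dle e p -> dle e (c *: p).
Proof. exact: leq_trans (msizeZ_le _ _). Qed.

Lemma dleMn e p m : dle e p -> dle e (p *+ m).
Proof. by move=> dp; elim: m => [|m IH]; rewrite ?mulr0n ?mulrS ?dle0 //; apply: dleD. Qed.

Lemma dle_sum e (I : Type) (r : seq I) (P : pred I) (F : I -> {mpoly k[n]}) :
  (forall i, P i -> dle e (F i)) -> dle e (\sum_(i <- r | P i) F i).
Proof. by move=> h; apply: (big_ind (fun p => dle e p)) => //; [exact: dle0|exact: dleD]. Qed.

Lemma dle_prod (I : Type) (r : seq I) (d : I -> nat) (F : I -> {mpoly k[n]}) :
  (forall i, dle (d i) (F i)) -> dle (\sum_(i <- r) d i) (\prod_(i <- r) F i).
Proof.
move=> h; elim/big_rec2: _ => [|i e p _ hp]; first exact: dle1.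
by apply: dleM.
Qed.

Lemma dleXn e m p : dle e p -> dle (m * e) (p ^+ m).
Proof.
move=> hp; elim: m => [|m IH]; first exact: dle1.
by rewrite exprS mulSn; apply: dleM.
Qed.

Lemma dle_sign e (b : nat) p : dle e p -> dle e ((-1) ^+ b * p).
Proof. by move=> hp; rewrite -signr_odd mulr_sign; case: ifP => // _; apply: dleN. Qed.

Lemma dle_det e r (A : 'M[{mpoly k[n]}]_r) :
  (forall i j, dle e (A i j)) -> dle (r * e) (\det A).
Proof.
move=> h; rewrite /determinant; apply: dle_sum => s _; apply: dle_sign.
rewrite -[r in (r * e)%N]card_ord -sum_nat_const.
by apply: (@dle_prod _ _ (fun=> e)) => i.
Qed.

Lemma dle_deriv e i p : dle e p -> dle e p^`M(i).
Proof.
rewrite /dle => h; rewrite msizeE; apply/bigmax_leqP_seq => m hm _.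
rewrite ltnS; move: hm; rewrite mcoeff_msupp mcoeff_deriv => hm.
have : (m + U_(i))%MM \in msupp p.
  by rewrite mcoeff_msupp; apply: contraNneq hm => ->; rewrite mul0rn.
move/msize_mdeg_lt/leq_trans => /(_ _ h); rewrite mdegD mdeg1; lia.
Qed.

Lemma dle_dvd e p q : q != 0 -> rdvd p q -> dle e q -> dle e p.
Proof.
move=> + [c E]; rewrite E mulf_eq0 negb_or => /andP[c0 p0].
rewrite /dle msizeM // => /(leq_trans _); apply.
by rewrite (mpolySpred mdeg c0) addSn /= leq_addl.
Qed.

End Degree.

Section Uni.
Variables (s : nat) (k : fieldType).
Implicit Types p q : {mpoly k[s.+1]}.
Local Notation wd := (widen_ord (leqnSn s)).

Lemma muni_var (i : 'I_s) : muni ('X_(wd i) : {mpoly k[s.+1]}) = ('X_i)%:P.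
Proof.
rewrite /muni /= mmapX mmap1U; case: splitP => [j eq|j].
  by congr ('X__)%:P; apply/val_inj=> /=; rewrite -eq.
by rewrite ord1 /= addn0 => /eqP /=; rewrite ltn_eqF.
Qed.

Lemma muni_last : muni ('X_ord_max : {mpoly k[s.+1]}) = 'X.
Proof.
rewrite /muni /= mmapX mmap1U; case: splitP=> //; case=> j lt_jn /eqP /=.
by have := lt_jn; rewrite ltn_neqAle eq_sym=> /andP[/negbTE->].
Qed.

Lemma ord_widen_max (P : 'I_s.+1 -> Prop) :
  (forall i, P (wd i)) -> P ord_max -> forall i, P i.
Proof.
move=> hw hm i; have [im|im] := eqVneq i ord_max; first by rewrite im.
have lt : (i < s)%N by move: (ltn_ord i) im; rewrite -val_eqE /=; lia.
by have -> : i = wd (Ordinal lt) by apply: val_inj.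
Qed.

(** The inverse of [muni], which views a polynomial as univariate in its last variable. *)
Definition munin (p : {poly {mpoly k[s]}}) : {mpoly k[s.+1]} :=
  (map_poly (@mwiden s k) p).['X_ord_max].

Lemma munin_is_zmod_morphism : zmod_morphism munin.
Proof. by move=> p q; rewrite /munin rmorphB hornerD hornerN. Qed.

Lemma munin_is_monoid_morphism : monoid_morphism munin.
Proof.
by split=> [|p q]; rewrite /munin ?rmorph1 ?rmorphM ?hornerM // hornerC.
Qed.

HB.instance Definition _ := GRing.isZmodMorphism.Build
  {poly {mpoly k[s]}} {mpoly k[s.+1]} munin munin_is_zmod_morphism.
HB.instance Definition _ := GRing.isMonoidMorphism.Build
  {poly {mpoly k[s]}} {mpoly k[s.+1]} munin munin_is_monoid_morphism.

Lemma muninC (r : {mpoly k[s]}) : munin r%:P = mwiden r.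
Proof. by rewrite /munin map_polyC hornerC. Qed.

Lemma muninX : munin 'X = 'X_ord_max.
Proof. by rewrite /munin map_polyX hornerX. Qed.

Lemma mwiden_var (i : 'I_s) : mwiden ('X_i : {mpoly k[s]}) = 'X_(wd i).
Proof. by rewrite /mwiden mmapX mmap1U. Qed.

Lemma muniK : cancel (@muni s k) munin.
Proof.
apply: (mpoly_morph_eq (f := munin \o @muni s k) (g := idfun)) => /= [c|].
  by rewrite muniC muninC mwidenC.
apply: ord_widen_max => [i|]; first by rewrite muni_var muninC mwiden_var.
by rewrite muni_last muninX.
Qed.

Lemma muni_mwiden (r : {mpoly k[s]}) : muni (mwiden r) = r%:P.
Proof.
apply: (mpoly_morph_eq (f := @muni s k \o @mwiden s k) (g := polyC)) => /= [c|i].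
  by rewrite mwidenC muniC.
by rewrite mwiden_var muni_var.
Qed.

Lemma muninK : cancel munin (@muni s k).
Proof.
elim/poly_ind => [|p c IH]; first by rewrite !rmorph0.
by rewrite !rmorphD !rmorphM /= IH muninX muni_last muninC muni_mwiden.
Qed.

Lemma rdvd_muni p q : rdvd (muni p) (muni q) <-> rdvd p q.
Proof.
split=> -[c E]; last by exists (muni c); rewrite E muniM.
by exists (munin c); rewrite -[q]muniK E rmorphM /= muniK.
Qed.

Lemma rprime_muni p : rprime (muni p) <-> rprime p.
Proof.
have mu0 q : (muni q == 0) = (q == 0).
  by rewrite -(inj_eq (can_inj muniK)) muni0.
split=> -[p0 p1 pp]; split.
- by rewrite -mu0.
- by move/rdvd_muni; rewrite muni1.
- by move=> a b /rdvd_muni; rewrite muniM => /pp[] /rdvd_muni; [left|right].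
- by rewrite mu0.
- by rewrite -(muni1 s k) => /rdvd_muni.
- move=> a b; rewrite -[a]muninK -[b]muninK -muniM => /rdvd_muni/pp.
  by case=> /rdvd_muni; [left|right].
Qed.

Lemma dle_muni_coef e p i : dle e p -> dle e (muni p)`_i.
Proof.
move=> hp; rewrite muniE coef_sum big_seq; apply: dle_sum => m hm.
rewrite coefZ coefXn; case: eqP => _; last by rewrite mulr0; apply: dle0.
rewrite mulr1; apply: dleZ; rewrite /dle msizeX ltnS.
have := msize_mdeg_lt hm; rewrite (mdegE m) big_ord_recr /= mdegE => lt.
rewrite (eq_bigr (fun i => m (wd i))) => [|j _]; last by rewrite mnmE.
by move: (leq_trans lt hp); lia.
Qed.

Lemma size_muni e p : dle e p -> (size (muni p) <= e.+1)%N.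
Proof.
move=> hp; rewrite muniE; apply: (leq_trans (size_sum _ _ _)).
apply/bigmax_leqP_seq => m hm _.
apply: (leq_trans (size_scale_leq _ _)); rewrite size_polyXn.
have := msize_mdeg_lt hm; rewrite (mdegE m) big_ord_recr /=.
by move=> /leq_trans /(_ hp); lia.
Qed.

Lemma dle_mwiden e (r : {mpoly k[s]}) : dle e r -> dle e (mwiden r).
Proof.
move=> dr; rewrite (mwidenE dr); apply: dle_sum => m _; apply: dleZ.
rewrite /dle msizeX mdegE big_ord_recr /= mnmwiden_ordmax addn0.
rewrite (eq_bigr (fun i => (m : 'X_{1..s}) i)) => [|i _]; last by rewrite mnmwiden_widen.
by rewrite -mdegE; apply: bmdeg.
Qed.

Lemma dle_munin e f (p : {poly {mpoly k[s]}}) : (size p <= f.+1)%N -> (forall l, dle e p`_l) ->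
  dle (e + f) (munin p).
Proof.
move=> sp dp; rewrite /munin (horner_coef_wide _ (n := f.+1)); last first.
  exact: leq_trans (size_poly _ _) sp.
apply: dle_sum => l _; rewrite coef_map; apply: (@dle_le _ _ (e + l)).
  by rewrite leq_add2l -ltnS.
apply: dleM; first exact: dle_mwiden.
by rewrite -[X in dle X _]muln1; apply/dleXn/dleX.
Qed.

End Uni.

Lemma ufd_mpoly (k : fieldType) n : ufd {mpoly k[n]}.
Proof.
elim: n => [|n IHn] p p0.
  move: p0; rewrite (nvar0_mpolyC p) mpolyC_eq0 => c0.
  exists (p@_0%MM)%:MP, ((p@_0%MM)^-1)%:MP, [::]; rewrite big_nil mulr1; split=> //.
  by rewrite -mpolyCM mulfV.
have [|u [v [ps [uv hp E]]]] := @ufd_poly _ IHn (muni p).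
  by rewrite -(inj_eq (can_inj (@muninK n k))) muniK rmorph0.
exists (munin u), (munin v), (map (@munin n k) ps); split.
- by rewrite -rmorphM uv rmorph1.
- move=> r /mapP[q /hp qP ->]; apply/rprime_muni; by rewrite muninK.
- by rewrite -[p]muniK E rmorphM rmorph_prod big_map.
Qed.

(** The polynomial [r] is the resultant in the last variable: a Sylvester determinant with at most
    [2 e] rows and entries of degree at most [e]. If [p] does not involve that variable, [p] itself
    serves. *)
Lemma prime_elimination (k : fieldType) s (q p : {mpoly k[s.+1]}) e :
  rprime q -> (1 < size (muni q))%N -> dle e q -> dle e p -> ~ rdvd q p ->
  exists r : {mpoly k[s]}, [/\ r != 0, dle (2 * e ^ 2) r &
    exists a b, mwiden r = a * q + b * p].
Proof.
move=> qP sq hq hp ndvd; have [sp|sp] := leqP (size (muni p)) 1.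
  exists (muni p)`_0; split.
  - apply/eqP => E; apply: ndvd; rewrite -[p]muniK (size1_polyC sp) E rmorph0.
    exact: rdvd0.
  - have e0 : (0 < e)%N by have := size_muni hq; lia.
    apply: (@dle_le _ _ e); last exact: dle_muni_coef.
    by rewrite -mulnn mulnA leq_pmull // muln_gt0.
  - exists 0, 1; rewrite -muninC -(size1_polyC sp) muniK; ring.
have qP' := (rprime_muni q).2 qP.
have ndvd' : ~ rdvd (muni q) (muni p) by move/rdvd_muni.
exists (resultant (muni q) (muni p)); split.
- exact: resultant_prime_neq0 qP' sq ndvd'.
- rewrite /resultant.
  apply: (@dle_le _ _ (((size (muni p)).-1 + (size (muni q)).-1) * e)%N).
    rewrite -mulnn mulnA leq_mul2r; have := size_muni hq; have := size_muni hp; lia.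
  apply: dle_det => i j; rewrite Sylvester_mxE.
  by case: split => l; case: (_ <= _)%N; rewrite ?mulr1n ?mulr0n ?dle0 //; apply: dle_muni_coef.
- have [a [b E]] := resultant_morph (@munin s k) sq sp.
  exists a, b; rewrite -muninC; apply: (etrans E).
  by congr (_ * _ + _ * _); exact: muniK.
Qed.

End MPolyFacts.

(** * The order gap *)

Section XOrder.
Variable k : fieldType.
Implicit Types a b : {poly k}.

Lemma rdvdXnP j a : rdvd 'X^j a <-> forall i, (i < j)%N -> a`_i = 0.
Proof.
split=> [[b -> i ij]|h]; first by rewrite coefMXn ij.
exists (drop_poly j a); rewrite -[LHS](poly_take_drop j) [take_poly _ _](_ : _ = 0) ?add0r //.
by apply/polyP => i; rewrite coef_take_poly coef0; case: ifP => // /h.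
Qed.

Lemma rdvdXn_le i j a : (i <= j)%N -> rdvd 'X^j a -> rdvd 'X^i a.
Proof. by move=> ij /rdvdXnP h; apply/rdvdXnP => l li; apply: h; apply: leq_trans ij. Qed.

Lemma rdvdXn_order j a : ~ rdvd 'X^j a ->
  exists v b, [/\ (v < j)%N, b`_0 != 0 & a = b * 'X^v].
Proof.
elim: j a => [|j IH] a; first by case; exists a; rewrite expr0 mulr1.
elim/poly_ind: a => [h|a c _ h]; first by case: h; apply: rdvd0.
have [c0|c0] := eqVneq c 0; last first.
  exists 0%N, (a * 'X + c%:P); rewrite expr0 mulr1; split=> //.
  by rewrite coefD coefMX coefC add0r.
case: (IH a) => [[b E]|v [b [vj b0 ->]]].
  by apply: h; exists b; rewrite c0 addr0 E exprSr mulrA.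
by exists v.+1, b; rewrite c0 addr0 exprSr mulrA.
Qed.

(** Orders at 0 add, and [(i - 1) + (j - 1)] is less than [i + j - 1]. *)
Lemma rdvdXnM_neg i j a b : (0 < i)%N -> (0 < j)%N ->
  ~ rdvd 'X^i a -> ~ rdvd 'X^j b -> ~ rdvd 'X^((i + j).-1) (a * b).
Proof.
move=> i0 j0 /rdvdXn_order[v [a' [vi a0 ->]]] /rdvdXn_order[w [b' [wj b0 ->]]].
rewrite mulrACA -exprD => /rdvdXnP/(_ (v + w)%N).
rewrite coefMXn ltnn subnn coef0M => E.
by move: (mulf_neq0 a0 b0); rewrite E ?eqxx //; lia.
Qed.

Lemma rdvdXn_deriv j a : rdvd 'X^j a -> rdvd 'X^(j.-1) a^`().
Proof.
by move/rdvdXnP => h; apply/rdvdXnP => i ij; rewrite coef_deriv h ?mul0rn //; lia.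
Qed.

End XOrder.

Lemma wide_kernel (k : fieldType) m n (A : 'M[k]_(m, n)) : (n < m)%N ->
  exists2 u : 'rV_m, u != 0 & u *m A = 0.
Proof.
move=> nm; exists (nz_row (kermx A)).
  rewrite nz_row_eq0 -mxrank_eq0 mxrank_ker subn_eq0 -ltnNge.
  exact: leq_ltn_trans (rank_leq_col A) nm.
by apply/sub_kermxP; apply: nz_row_sub.
Qed.

(* If every weight is at least [E] times the previous one, exponents below [E] are the digits
   of the weighted sum. *)
Section Weights.
Variables (E : nat) (v : nat -> nat).
Hypothesis v0 : (0 < v 0)%N.

Lemma weight_lt r (e : nat -> nat) : (forall i, (e i < E)%N) ->
  (forall i, (i < r)%N -> (E * v i <= v i.+1)%N) ->
  (\sum_(i < r) e i * v i < v r)%N.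
Proof.
move=> he; elim: r => [|r IH] hv; first by rewrite big_ord0.
rewrite big_ord_recr /=; apply: leq_trans (hv r _) => //.
have IH' : (\sum_(i < r) e i * v i < v r)%N by apply: IH => i ir; apply: hv; apply: ltnW.
have : (e r * v r + v r <= E * v r)%N.
  by rewrite -[X in (_ + X)%N]mul1n -mulnDl leq_mul2r addn1 he orbT.
by apply: leq_trans; rewrite addnC -addnS leq_add2l.
Qed.

Lemma weight_inj r (e f : nat -> nat) : (forall i, (e i < E)%N) -> (forall i, (f i < E)%N) ->
  (forall i, (i.+1 < r)%N -> (E * v i <= v i.+1)%N) ->
  (\sum_(i < r) e i * v i = \sum_(i < r) f i * v i)%N ->
  forall i, (i < r)%N -> e i = f i.
Proof.
move=> he hf; elim: r => [|r IH] hv //.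
rewrite !big_ord_recr /= => S.
have le := weight_lt he hv; have lf := weight_lt hf hv.
have er : e r = f r.
  wlog lt : e f he hf le lf S {IH} / (e r < f r)%N.
    move=> W; case: (ltngtP (e r) (f r)) => // h; first exact: (W e f).
    by apply/esym/(W f e).
  have : (e r * v r + v r <= f r * v r)%N.
    by rewrite -[X in (_ + X)%N]mul1n -mulnDl leq_mul2r addn1 lt orbT.
  move: S le; move: (\sum_(i < r) e i * v i)%N (\sum_(i < r) f i * v i)%N.
  by move: (f r * v r)%N (e r * v r)%N (v r) => x y w a b; lia.
move=> i; rewrite ltnS leq_eqVlt => /orP[/eqP->//|]; apply: IH.
  by move=> j jr; apply: hv; apply: ltnW.
by move: S; rewrite er => /addIn.
Qed.

End Weights.

Module Gap. Import mpoly MPolyFacts.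

(** There are [E ^ r] products with exponents below [E]. Their coefficients are indexed by exponents
    in a box of side [r (E - 1) d + 1] in dimension [N], which is smaller. *)
Lemma algebraic_dependence (k : fieldType) N r d E (p : 'I_r -> {mpoly k[N]}) :
  (forall i, dle d (p i)) -> ((r * (E.-1 * d)).+1 ^ N < E ^ r)%N ->
  exists c : {ffun 'I_r -> 'I_E} -> k, (exists e, c e != 0) /\
    \sum_e c e *: \prod_i p i ^+ e i = 0.
Proof.
move=> hp lt; pose M := (r * (E.-1 * d))%N.
pose P (e : {ffun 'I_r -> 'I_E}) := \prod_i p i ^+ e i.
have hP e : dle M (P e).
  rewrite /M -[r in (r * _)%N]card_ord -sum_nat_const.
  apply: (@dle_prod _ _ _ _ (fun=> E.-1 * d)%N) => i.
  apply: (@dle_le _ _ (e i * d)); last exact: dleXn.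
  rewrite leq_mul2r; have := ltn_ord (e i); move: (nat_of_ord _) => x.
  by case: (E) => // E'; rewrite ltnS /= => ->; rewrite orbT.
pose mon (b : {ffun 'I_N -> 'I_M.+1}) := [multinom (b i : nat) | i < N].
pose A := \matrix_(a < #|{ffun 'I_r -> 'I_E}|, b < #|{ffun 'I_N -> 'I_M.+1}|)
            (P (enum_val a))@_(mon (enum_val b)).
have [|u u0 uA] := @wide_kernel k _ _ A; first by rewrite !card_ffun !card_ord.
exists (fun e => u 0 (enum_rank e)); split.
  have [j uj] : exists j, u 0 j != 0.
    apply/existsP; apply: contraNT u0; rewrite negb_exists => /forallP h.
    by apply/eqP/rowP => j; rewrite mxE; apply/eqP; rewrite -[_ == _]negbK h.
  by exists (enum_val j); rewrite enum_valK.
apply/mpolyP => m; rewrite mcoeff0 raddf_sum /=.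
have [hm|hm] := boolP [forall i, m i <= M]%N; last first.
  rewrite big1 // => e _; rewrite mcoeffZ [_@_m](_ : _ = 0) ?mulr0 //.
  apply: memN_msupp_eq0; apply: msize_mdeg_ge; apply: leq_trans (hP e) _.
  have [i hi] : exists i, ~~ (m i <= M)%N by apply/existsP; rewrite -negb_forall.
  rewrite -ltnNge in hi; apply: leq_trans hi _.
  by rewrite mdegE (bigD1 i) //= leq_addr.
pose b : {ffun 'I_N -> 'I_M.+1} := [ffun i => inord (m i)].
have mb : mon b = m.
  by apply/mnmP => i; rewrite mnmE ffunE inordK // ltnS (forallP hm).
have := congr1 (fun B : 'rV_ _ => B 0 (enum_rank b)) uA; rewrite !mxE => E0.
rewrite -[RHS]E0 (reindex (@enum_val _ {ffun 'I_r -> 'I_E})) /=; last first.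
  by exists enum_rank => x _; rewrite ?enum_valK ?enum_rankK.
by apply: eq_bigr => a _; rewrite mcoeffZ !mxE enum_valK enum_rankK mb.
Qed.

(** Writing this as [E = F + 1], the box of side [(N + 1) F d + 1] has at most
    [((N + 1) d E) ^ N = F * E ^ N] points, fewer than [E ^ (N + 1)]. *)
Definition gapE N d := ((N.+1 * d) ^ N + 1)%N.

Lemma gapE_count N d : (0 < d)%N ->
  ((N.+1 * ((gapE N d).-1 * d)).+1 ^ N < gapE N d ^ N.+1)%N.
Proof.
move=> d0; rewrite /gapE addn1 /=; set F := ((N.+1 * d) ^ N)%N.
have le : ((N.+1 * (F * d)).+1 <= N.+1 * d * F.+1)%N.
  by rewrite [(F * d)%N]mulnC mulnA mulnS -addn1 addnC leq_add2r muln_gt0.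
apply: (@leq_ltn_trans ((N.+1 * d * F.+1) ^ N)%N); first by case: (N) le => // n; rewrite leq_exp2r.
by rewrite expnMn -/F expnS ltn_mul2r expn_gt0 /= ltnSn.
Qed.

(** Without a gap there are [N + 1] polynomials whose orders along [z] grow so fast that all their
    products with exponents below [E] have distinct orders. Being more numerous than the variables,
    they satisfy a relation, whose term of least order cannot cancel. *)
Theorem order_gap (k : fieldType) N d K (z : 'I_N -> {poly k}) : (0 < d)%N ->
  (2 * (2 * gapE N d) ^ N <= K)%N ->
  exists A, [/\ (0 < A)%N, (2 * A <= K)%N & forall p : {mpoly k[N]}, dle d p ->
    rdvd 'X^A (mmap polyC z p) -> rdvd 'X^(2 * A) (mmap polyC z p)].
Proof.
move=> d0 hK; apply: boolp.contrapT => nogap.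
(* An order in [[A i.+1, 2 * A i.+1)] is at least [2 E * A i], hence at least [E] times any order in
   [[A i, 2 * A i)]. *)
set E := gapE N d in hK; pose A i := ((2 * E) ^ i)%N.
have E0 : (0 < E)%N by rewrite /E /gapE addn1.
have A0 i : (0 < A i)%N by rewrite expn_gt0 muln_gt0 E0.
have pick (i : nat) : exists x : {mpoly k[N]} * (nat * {poly k}), (i <= N)%N ->
    [/\ dle d x.1, (A i <= x.2.1 < 2 * A i)%N, x.2.2`_0 != 0 &
       mmap polyC z x.1 = x.2.2 * 'X^(x.2.1)].
  have [iN|iN] := boolP (i <= N)%N; last by exists (0, (0%N, 0)) => h; case/negP: iN.
  have [] := boolp.EM (exists p : {mpoly k[N]}, [/\ dle d p,
    rdvd 'X^(A i) (mmap polyC z p) & ~ rdvd 'X^(2 * A i) (mmap polyC z p)]).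
    case=> p [dp /rdvdXnP h1 /rdvdXn_order[v [b [v2 b0 Eb]]]].
    exists (p, (v, b)) => _; split=> //=; rewrite v2 andbT leqNgt; apply/negP => vA.
    by move: (h1 _ vA); rewrite Eb coefMXn ltnn subnn => E1; rewrite E1 eqxx in b0.
  move=> no; case: nogap; exists (A i); split=> //.
    apply: leq_trans hK; rewrite leq_mul2l /=; apply: leq_pexp2l => //.
    by rewrite muln_gt0 E0.
  by move=> p dp h1; apply: boolp.contrapT => h2; apply: no; exists p.
have [x hx] := boolp.choice pick.
pose p (i : 'I_N.+1) := (x i).1; pose v i := (x i).2.1; pose b i := (x i).2.2.
have [] := @algebraic_dependence k N N.+1 d E p.
- by move=> i; have [] := hx i (ltn_ord i).
- exact: gapE_count.
move=> c [[e1 ce1] rel]; pose wt (e : {ffun 'I_N.+1 -> 'I_E}) := (\sum_i e i * v i)%N.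
(* By distinctness of weights, [e0] alone contributes to the coefficient of ['X^(wt e0)], and its
   contribution is nonzero. *)
pose e0 := [arg min_(e < e1 | c e != 0) wt e].
have [ce0 min0] : c e0 != 0 /\ forall e, c e != 0 -> (wt e0 <= wt e)%N.
  by rewrite /e0; case: arg_minnP => // e ce h; split.
have vE i : (i < N)%N -> (E * v i <= v i.+1)%N.
  move=> iN; have [_ /andP[_ u1] _ _] := hx i (ltnW iN).
  have [_ /andP[l2 _] _ _] := hx i.+1 iN; rewrite /v.
  apply: leq_trans l2; rewrite /A expnS -/(A i) -mulnA mulnCA.
  by apply: leq_mul => //; apply: ltnW.
have v0 : (0 < v 0)%N.
  have [_ /andP[l _] _ _] := hx 0%N isT.
  by apply: leq_trans l; apply: A0.
have wt_inj e : wt e = wt e0 -> e = e0.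
  move=> S; apply/ffunP => i; apply/val_inj.
  pose ext (e : {ffun 'I_N.+1 -> 'I_E}) j : nat := e (inord j).
  have extE (e' : {ffun 'I_N.+1 -> 'I_E}) : wt e' = (\sum_(j < N.+1) ext e' j * v j)%N.
    by apply: eq_bigr => j _; rewrite /ext inord_val.
  have := @weight_inj E v v0 N.+1 (ext e) (ext e0) _ _ _ _ i (ltn_ord i).
  rewrite /ext !inord_val; apply.
  - by move=> j.
  - by move=> j.
  - by move=> j; apply: vE.
  - by rewrite -!extE.
pose B (e : {ffun 'I_N.+1 -> 'I_E}) := \prod_(i < N.+1) b i ^+ e i.
have termE (e : {ffun 'I_N.+1 -> 'I_E}) : mmap polyC z (c e *: \prod_i p i ^+ e i)
    = c e *: (B e * 'X^(wt e)).
  rewrite mmapZ mul_polyC; congr (_ *: _); rewrite rmorph_prod /= /B /wt.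
  rewrite (eq_bigr (fun i : 'I_N.+1 => b i ^+ e i * 'X^(e i * v i))).
    rewrite big_split /=; congr (_ * _).
    by elim/big_rec2: _ => [|i a1 a2 _ ->]; rewrite ?expr0 ?exprD.
  move=> i _; have [_ _ _ Ei] := hx i (ltn_ord i).
  by rewrite rmorphXn /= /p Ei exprMn -exprM mulnC.
have relE : \sum_e c e *: (B e * 'X^(wt e)) = 0.
  rewrite -[RHS](rmorph0 (mmap polyC z)) -rel rmorph_sum.
  by apply: eq_bigr => e _; apply/esym; exact: termE.
have := congr1 (fun P : {poly k} => P`_(wt e0)) relE.
rewrite coef0 coef_sum (bigD1 e0) //= big1 ?addr0.
  rewrite coefZ coefMXn ltnn subnn => /eqP; apply/negP.
  apply: mulf_neq0 => //; rewrite /B; elim/big_rec: _ => [|i a _ ha].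
    by rewrite coef1 oner_neq0.
  have [_ _ bi0 _] := hx i (ltn_ord i).
  rewrite coef0M mulf_neq0 //; elim: (e0 i : nat) => [|l IH].
    by rewrite expr0 coef1 oner_neq0.
  by rewrite exprS coef0M mulf_neq0.
move=> e ne; rewrite coefZ coefMXn; have [->|ce] := eqVneq (c e) 0.
  by rewrite mul0r.
suff -> : (wt e0 < wt e)%N by rewrite mulr0.
rewrite ltn_neqAle min0 // andbT; apply: contraNneq ne => W; apply/eqP.
exact: wt_inj.
Qed.

End Gap.

(** * Linear algebra over polynomials and modulo a prime *)

Module Krull. Import classical_sets boolp.
Local Open Scope quotient_scope.

Section ResidueField.
Variables (A : comNzRingType) (M : A -> Prop).
Hypotheses (idM : is_ideal M) (properM : ~ M 1).
Hypothesis maxM : forall a, ~ M a -> exists2 b, M b & exists c, 1 = b + c * a.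

Definition max_pred (a : A) : bool := `[< M a >].

Lemma max_pred_idealr : idealr_closed max_pred.
Proof.
have [M0 MD MM] := idM; split.
- exact/asboolP.
- by apply/negP => /asboolP.
- by move=> a u v /asboolP Mu /asboolP Mv; apply/asboolP/MD => //; apply: MM.
Qed.

HB.instance Definition _ := isIdealr.Build A max_pred max_pred_idealr.

Definition max_ideal : idealr A := max_pred.

Definition residue := {ideal_quot max_ideal}.

HB.instance Definition _ := GRing.ComNzRing.on residue.

Lemma residue_eqP a b : \pi_residue a = \pi_residue b <-> M (a - b).
Proof.
have := Quotient.idealrBE max_ideal a b; rewrite unfold_in /= => E.
by split=> [/eqP|/asboolP h]; [rewrite -E => /asboolP|apply/eqP; rewrite -E].
Qed.

Lemma residue_ex_inv (x : residue) : exists y : residue,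
  (x != 0 -> y * x = 1) /\ (x = 0 -> y = 0).
Proof.
have [->|x0] := eqVneq x 0; first by exists 0; split=> //; rewrite eqxx.
have nM : ~ M (repr x).
  move=> h; case/negP: x0; rewrite -[x]reprK -(rmorph0 (\pi_residue)).
  by apply/eqP/residue_eqP; rewrite subr0.
have [b Mb [c E]] := maxM nM.
exists (\pi c); split=> [_|E0]; last by rewrite E0 eqxx in x0.
rewrite -[x]reprK.
have -> : 1 = \pi_residue 1 :> residue by rewrite rmorph1.
rewrite -rmorphM; apply/residue_eqP; have [_ _ MM] := idM.
by rewrite E opprD addrCA subrr addr0 -mulN1r; apply: MM.
Qed.

Definition residue_inv (x : residue) : residue := sval (cid (residue_ex_inv x)).

Lemma residue_mulVx : forall x : residue, x != 0 -> residue_inv x * x = 1.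
Proof. by move=> x x0; have [h _] := svalP (cid (residue_ex_inv x)); apply: h. Qed.

Lemma residue_inv0 : residue_inv 0 = 0.
Proof. by have [_ h] := svalP (cid (residue_ex_inv 0)); apply: h. Qed.

HB.instance Definition _ := GRing.ComNzRing_isField.Build residue
  residue_mulVx residue_inv0.

Lemma maximal_quotient :
  exists (K : fieldType) (f : {rmorphism A -> K}), forall a, M a -> f a = 0.
Proof.
exists residue, (\pi_residue) => a Ma.
by rewrite -(rmorph0 (\pi_residue)); apply/residue_eqP; rewrite subr0.
Qed.

End ResidueField.

Theorem residue_field (A : comNzRingType) (J : A -> Prop) :
  is_ideal J -> ~ J 1 ->
  exists (K : fieldType) (f : {rmorphism A -> K}), forall a, J a -> f a = 0.
Proof.
move=> idJ J1.
pose good (S : set A) := [/\ is_ideal S, ~ S 1 & forall a, J a -> S a].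
have [S [gS maxS]] : exists S, (S = set0 \/ good S) /\
    forall T, (S `<` T)%classic -> ~ (T = set0 \/ good T).
  apply: Zorn_bigcup => F FP tot.
  have [[X0 FX0 gX0]|no] := EM (exists2 X, F X & good X); last first.
    left; rewrite -subset0 => a [X FX Xa]; have [X0|gX] := FP _ FX.
      by rewrite X0 in Xa.
    by case: no; exists X.
  have [[X00 X0D X0M] X01 JX0] := gX0.
  have gF X a : F X -> X a -> good X.
    by move=> FX Xa; have [E|//] := FP _ FX; rewrite E in Xa.
  right; split; first split.
  - by exists X0.
  - move=> x y [X FX Xx] [Y FY Yy].
    have [[_ XD _] _ _] := gF _ _ FX Xx; have [[_ YD _] _ _] := gF _ _ FY Yy.
    case: (tot _ _ FX FY) => sub; first by exists Y => //; apply: YD => //; apply: sub.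
    by exists X => //; apply: XD => //; apply: sub.
  - move=> r x [X FX Xx]; have [[_ _ XM] _ _] := gF _ _ FX Xx.
    by exists X => //; apply: XM.
  - by move=> [X FX X1]; have [_ + _] := gF _ _ FX X1; apply.
  - by move=> a Ja; exists X0 => //; apply: JX0.
have {gS} [idS S1 JS] : good S.
  case: gS => // S0; case: (maxS J); last by right; split.
  rewrite S0 properEneq; split => //; apply/eqP => E.
  by have [J0 _ _] := idJ; have : (set0 : set A) 0 by rewrite E.
have [S0 SD SM] := idS.
have maxM a : ~ S a -> exists2 b, S b & exists c, 1 = b + c * a.
  move=> Sa; apply: contrapT => no.
  pose T : set A := fun x => exists2 b, S b & exists c, x = b + c * a.
  have ST : (S `<=` T)%classic by move=> b Sb; exists b => //; exists 0; rewrite mul0r addr0.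
  have Ta : T a by exists 0 => //; exists 1; rewrite mul1r add0r.
  apply: (maxS T).
    by rewrite properEneq; split => //; apply/eqP => E; apply: Sa; rewrite E.
  right; split=> //; last by move=> b /JS /ST.
  split; first exact: ST.
  - move=> x y [b Sb [c ->]] [b' Sb' [c' ->]]; exists (b + b'); first exact: SD.
    by exists (c + c'); ring.
  - move=> r x [b Sb [c ->]]; exists (r * b); first exact: SM.
    by exists (r * c); ring.
have [K [f f0]] := maximal_quotient idS S1 maxM.
by exists K, f => a /JS /f0.
Qed.

End Krull.

Section CharZero.
Variable k : fieldType.
Hypothesis ch0 : [pchar k] =i pred0.

Lemma natr_neq0 n : n.+1%:R != 0 :> k.
Proof. by rewrite (pcharf0P k).1. Qed.

Lemma natr_inj : injective (fun n => n%:R : k).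
Proof.
move=> m n /=; wlog mn : m n / (m <= n)%N.
  by move=> W E; case: (leqP m n) => h; [apply: W|apply/esym/W => //; apply: ltnW].
move=> E; apply/eqP; rewrite eqn_leq mn /= -subn_eq0.
by rewrite -((pcharf0P k).1 ch0) natrB // E subrr.
Qed.

Lemma poly_nonroot (f : {poly k}) : f != 0 -> exists x, f.[x] != 0.
Proof.
move=> f0; apply: boolp.contrapT => no.
have := max_poly_roots (rs := [seq n%:R | n <- iota 0 (size f)]) f0.
rewrite size_map size_iota ltnn => H; have : false; last by [].
apply: H; last by rewrite map_inj_uniq ?iota_uniq //; apply: natr_inj.
apply/allP => x _; rewrite /root; apply/eqP; apply: boolp.contrapT => /eqP h.
by apply: no; exists x.
Qed.

End CharZero.

Section Fractions.
Import FracField.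
Local Open Scope quotient_scope.

Lemma fraction_numden (R : idomainType) (x : {fraction R}) :
  exists a b : R, b != 0 /\ x * tofrac b = tofrac a.
Proof.
elim/quotW: x => y; exists \n_y, \d_y; split; first exact: denom_ratioP.
unlock tofrac; rewrite -[LHS]pi_mul; apply/eqmodP; rewrite /= equivfE /mulf.
rewrite !numden_Ratio ?mulf_neq0 ?oner_neq0 ?denom_ratioP //.
by rewrite !mulr1 mulrC.
Qed.

End Fractions.

Section KernelFamily.
Variable k : fieldType.

(** A kernel vector vanishing at 0 is divisible by ['X], and the quotient stays in the kernel; the
    size of a fixed nonzero entry decreases. *)
Lemma polynomial_kernel (p r : nat) (M : 'M[{poly k}]_(p, r)) (a : 'rV_p) :
  a != 0 -> a *m M = 0 ->
  exists2 b : 'rV_p, b *m M = 0 & map_mx (horner_eval 0) b != 0.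
Proof.
move=> a0; have [j aj] : exists j, a 0 j != 0.
  apply/existsP; apply: contraNT a0; rewrite negb_exists => /forallP h.
  by apply/eqP/rowP => j; rewrite mxE; apply/eqP; rewrite -[_ == _]negbK h.
move: {2}(size _) (leqnn (size (a 0 j))) => n.
elim: n a {a0} aj => [|n IH] a aj; first by rewrite leqn0 size_poly_eq0 (negPf aj).
move=> sz E; have [h|h] := eqVneq (map_mx (horner_eval 0) a) 0; last by exists a.
pose b := map_mx (fun f : {poly k} => drop_poly 1 f) a.
have ab : a = 'X *: b.
  apply/rowP => i; rewrite !mxE -[LHS](poly_take_drop 1) expr1 mulrC.
  rewrite [take_poly _ _](_ : _ = 0) ?add0r //.
  have := congr1 (fun m : 'rV_p => m 0 i) h; rewrite !mxE /horner_eval horner_coef0 => h0.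
  apply/polyP => l; rewrite coef_take_poly coef0 ltnS leqn0.
  by case: eqP => // ->.
have Xb : 'X * b 0 j != 0 by move: aj; rewrite {1}ab mxE.
have b0 : b 0 j != 0 by apply: contraNneq Xb => ->; rewrite mulr0.
apply: (IH b) => //.
  by move: sz; rewrite {1}ab mxE mulrC size_mulX.
move: E; rewrite ab -scalemxAl => E.
apply/rowP => i; have := congr1 (fun m : 'rV_r => m 0 i) E; rewrite !mxE => /eqP.
by rewrite mulf_eq0 polyX_eq0 /= => /eqP.
Qed.

(** Over the fraction field the rows are either independent, giving a nonzero maximal minor, or
    dependent, and then a relation is cleared of denominators. *)
Lemma fraction_kernel (R : idomainType) (p r : nat) (M : 'M[R]_(p, r)) :
  (exists2 a : 'rV_p, a != 0 & a *m M = 0) \/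
  (exists f : 'I_p -> 'I_r, \det (rowsub f M^T) != 0).
Proof.
pose F := map_mx (@FracField.tofrac R) M.
have [fr|nfr] := boolP (row_free F).
  right; have ff : row_full F^T by rewrite /row_full mxrank_tr.
  have fU : rowsub (fullrankfun ff) F^T \in unitmx.
    by rewrite -row_full_unit /row_full mxrank_fullrowsub.
  exists (fullrankfun ff); move: (fullrankfun ff : _ -> _) fU => f.
  rewrite unitmxE unitfE; apply: contraNneq => D0.
  by rewrite /F map_trmx -map_mxsub det_map_mx D0 rmorph0.
left; have k0 : kermx F != 0 by rewrite kermx_eq0.
have v0 : nz_row (kermx F) != 0 by rewrite nz_row_eq0.
have vF : nz_row (kermx F) *m F = 0 by apply/sub_kermxP; apply: nz_row_sub.
move: (nz_row _) v0 vF => v v0 vF.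
have /boolp.choice[nd hnd] : forall j, exists x : R * R,
    x.2 != 0 /\ v 0 j * FracField.tofrac x.2 = FracField.tofrac x.1.
  by move=> j; have [a [b ab]] := fraction_numden (v 0 j); exists (a, b).
pose d := \prod_j (nd j).2; have d0 : d != 0.
  by apply/prodf_neq0 => j _; have [] := hnd j.
pose a := \row_j ((nd j).1 * \prod_(i | i != j) (nd i).2).
have aE j : FracField.tofrac (a 0 j) = v 0 j * FracField.tofrac d.
  by rewrite mxE /d [X in _ = _ * FracField.tofrac X](bigD1 j) //= !rmorphM mulrA (hnd j).2.
exists a.
  apply: contraNneq v0 => a0; apply/eqP/rowP => j; rewrite [RHS]mxE; apply/eqP.
  have := aE j; rewrite a0 mxE tofrac0 => /esym/eqP.
  by rewrite mulf_eq0 tofrac_eq0 (negPf d0) orbF.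
apply/rowP => l; apply/eqP; rewrite [X in _ == X]mxE -tofrac_eq0 mxE rmorph_sum /=.
rewrite (eq_bigr (fun j => FracField.tofrac d * (v 0 j * F j l))) => [|j _].
  have := congr1 (fun m : 'rV_r => m 0 l) vF; rewrite !mxE => vF0.
  by rewrite -mulr_sumr vF0 mulr0.
by rewrite rmorphM /= aE [F j l]mxE mulrCA mulrA.
Qed.

(** A nonzero maximal minor would be nonzero at some [x], the field being infinite, and the rows of
    [M] at that [x] would be independent. So there is a polynomial kernel vector. *)
Lemma kernel_family (p r : nat) (M : 'M[{poly k}]_(p, r)) :
  [pchar k] =i pred0 ->
  (forall x : k, exists2 u : 'rV_p, u != 0 & u *m map_mx (horner_eval x) M = 0) ->
  exists2 b : 'rV_p, b *m M = 0 & map_mx (horner_eval 0) b != 0.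
Proof.
move=> ch0 h; case: (fraction_kernel M) => [[a a0 aM]|[f /(poly_nonroot ch0)[x]]].
  exact: polynomial_kernel a0 aM.
rewrite -/(horner_eval x _) -det_map_mx map_mxsub -map_trmx => Dx.
have [u u0 uM] := h x; case/negP: u0.
have Du : rowsub f (map_mx (horner_eval x) M)^T \in unitmx by rewrite unitmxE unitfE.
rewrite -trmx_eq0 -(mulKmx Du u^T) mul_rowsub_mx -trmx_mul uM trmx0.
by rewrite (_ : rowsub f 0 = 0) ?mulmx0 //; apply/matrixP => i j; rewrite !mxE.
Qed.

End KernelFamily.

Section CramerModPrime.
Variable R : idomainType.

(** Multiplication by [B] makes the matrix block lower triangular; the factor
    [\det A * \det (\adj A) = \det A ^+ r] is then cancelled. *)
Lemma det_bordered r (A : 'M[R]_r) (c : 'cV_r) (l : 'rV_r) (d : 'M_1) :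
  \det A != 0 ->
  \det (block_mx A c l d) = \det A * d 0 0 - (l *m \adj A *m c) 0 0.
Proof.
move=> A0; pose B := block_mx (\adj A) (- (\adj A *m c)) 0 (\det A)%:M.
have E : block_mx A c l d *m B =
    block_mx (\det A)%:M 0 (l *m \adj A) ((\det A)%:M *m d - l *m \adj A *m c).
  rewrite mulmx_block !mulmx0 !addr0 mul_mx_adj; congr block_mx.
    by rewrite mulmxN mulmxA mul_mx_adj mul_scalar_mx mul_mx_scalar addNr.
  by rewrite mulmxN mulmxA addrC mul_mx_scalar -mul_scalar_mx.
have := congr1 (@determinant _ _) E.
rewrite det_mulmx det_lblock det_ublock !det_scalar expr1 det_mx11.
have adjA : \det A * \det (\adj A) = \det A ^+ r.
  by rewrite -det_mulmx mul_mx_adj det_scalar.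
set x := \det (block_mx _ _ _ _) => H.
have An0 : \det A ^+ r != 0 by rewrite expf_neq0.
apply: (mulfI An0); rewrite [X in _ = _ * X](_ : _ =
  ((\det A)%:M *m d - l *m \adj A *m c) 0 0); last by rewrite mul_scalar_mx !mxE.
by rewrite -H -{1}adjA; ring.
Qed.

Variable q : R.
Hypothesis qP : rprime q.
Variables (a b : nat) (M : 'M[R]_(a, b)).

(* The minor of [M] on the rows [I] and columns [J], bordered by the row [i0] and the column [c]
   of a right-hand side. *)
Definition bordered r (I : 'I_r -> 'I_a) (J : 'I_r -> 'I_b) i0 (c : 'cV[R]_a) : R :=
  \det (mxsub I J M) * c i0 0 -
  (mxsub (fun=> i0 : 'I_a) J M *m \adj (mxsub I J M) *m rowsub I c : 'M_1) 0 0.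

(** Here [r] is the rank of [M] modulo [q]. Bordering by a column of [M] itself gives a minor of
    size [r + 1], divisible by [q] by maximality. *)
Lemma maximal_minor : exists r (I : 'I_r -> 'I_a) (J : 'I_r -> 'I_b),
  [/\ (r <= a)%N, ~ rdvd q (\det (mxsub I J M)) &
      forall i0 l, rdvd q (bordered I J i0 (col l M))].
Proof.
pose P r := exists (I : 'I_r -> 'I_a) (J : 'I_r -> 'I_b), ~ rdvd q (\det (mxsub I J M)).
have [q0 q1 qq] := qP.
have P0 : P 0%N.
  have f n (i : 'I_0) : 'I_n by case: i.
  by exists (f a), (f b); rewrite det_mx00.
have Pa : ~ P a.+1.
  move=> [I [J]]; apply; have [i [j ij E]] : exists i, exists2 j, i != j & I i = I j.
    apply: boolp.contrapT => no; have /leq_card : injective I.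
      move=> i j E; apply/eqP; apply: boolp.contrapT => /negP ij.
      by apply: no; exists i, j.
    by rewrite !card_ord ltnn.
  rewrite (determinant_alternate ij) => [|l]; last by rewrite !mxE E.
  exact: rdvd0.
have [r ra [[I [J hIJ]] nP]] : exists2 r, (r <= a)%N & P r /\ ~ P r.+1.
  apply: boolp.contrapT => no; apply: Pa.
  suff : forall r, (r <= a.+1)%N -> P r by apply.
  elim=> [//|r IH] ra; apply: boolp.contrapT => nP.
  by apply: no; exists r => //; split=> //; apply: IH; apply: ltnW.
exists r, I, J; split=> // i0 l; apply: boolp.contrapT => ndvd; apply: nP.
rewrite /P -addn1.
exists (fun x => match split x with inl i => I i | inr _ => i0 end).
exists (fun x => match split x with inl j => J j | inr _ => l end).
set B := mxsub _ _ M; suff -> : \det B = bordered I J i0 (col l M) by [].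
have Bl (i : 'I_r) : split (lshift 1 i) = inl i by rewrite -[lshift _ _]/(unsplit (inl i)) unsplitK.
have Br (i : 'I_1) : split (rshift r i) = inr i by rewrite -[rshift _ _]/(unsplit (inr i)) unsplitK.
have BE : B = block_mx (mxsub I J M) (rowsub I (col l M)) (mxsub (fun=> i0) J M)
    (const_mx (M i0 l)).
  rewrite -[B]submxK; congr block_mx; apply/matrixP => i j; rewrite !mxE ?Bl ?Br //.
rewrite BE det_bordered /bordered ?mxE //.
by apply/eqP => E; apply: hIJ; rewrite E; apply: rdvd0.
Qed.

(** Cramer's rule over the fraction field of [R / q], with the maximal minor as denominator. The
    error in row [i] is, up to sign, the minor bordered by that row and by [c]. *)
Lemma solve_mod_prime (c : 'cV[R]_a) :
  (forall r (I : 'I_r -> 'I_a) (J : 'I_r -> 'I_b) i0, (r <= a)%N ->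
     (forall l, rdvd q (bordered I J i0 (col l M))) -> rdvd q (bordered I J i0 c)) ->
  exists (Y : 'cV[R]_b) D, ~ rdvd q D /\
    forall i, rdvd q ((M *m Y) i 0 - D * c i 0).
Proof.
move=> h; have [r [I [J [ra hIJ hcol]]]] := maximal_minor.
set A := mxsub I J M in hIJ.
pose y := \adj A *m rowsub I c.
(* Unknowns outside the chosen columns are 0; summing makes injectivity of [J] unnecessary to
   prove. *)
pose Y : 'cV[R]_b := \col_l \sum_(j | J j == l) y j 0.
exists Y, (\det A); split=> // i.
have -> : (M *m Y) i 0 = (mxsub (fun=> i : 'I_a) J M *m y : 'M_1) 0 0.
  rewrite !mxE (eq_bigr (fun l => \sum_(j | J j == l) M i (J j) * y j 0)).
    rewrite (exchange_big_dep predT) //=; apply: eq_bigr => j _.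
    by rewrite (big_pred1 (J j)) => [|l]; [rewrite !mxE|rewrite /= eq_sym].
  by move=> l _; rewrite mxE mulr_sumr; apply: eq_bigr => j /eqP->.
have := rdvdN (h r I J i ra (hcol i)).
by rewrite /bordered opprB -mulmxA.
Qed.

(** Bordered minors are linear in the bordering column. A solution [y] of the system modulo [T] thus
    transfers their vanishing from the columns of [M] to the right-hand side. *)
Lemma bordered_eval (S : comNzRingType) (f : {rmorphism R -> S}) (T : S -> Prop)
    (y : 'I_b -> S) (c : 'cV[R]_a) r (I : 'I_r -> 'I_a) (J : 'I_r -> 'I_b) i0 :
  is_ideal T -> (forall i, T (f (c i 0) - \sum_l y l * f (M i l))) ->
  (forall l, T (f (bordered I J i0 (col l M)))) -> T (f (bordered I J i0 c)).
Proof.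
move=> [T0 TD TM] hc hl.
pose v : 'rV_r := mxsub (fun=> i0 : 'I_a) J M *m \adj (mxsub I J M).
have bE c' : f (bordered I J i0 c') =
    f (\det (mxsub I J M)) * f (c' i0 0) - \sum_j f (v 0 j) * f (c' (I j) 0).
  rewrite /bordered -/v rmorphB rmorphM [(_ *m _) 0 0]mxE; congr (_ - _).
  rewrite rmorph_sum.
  by apply: eq_bigr => j _; rewrite rmorphM !mxE.
have -> : f (bordered I J i0 c) =
    \sum_l y l * f (bordered I J i0 (col l M)) +
    (f (\det (mxsub I J M)) * (f (c i0 0) - \sum_l y l * f (M i0 l)) -
     \sum_j f (v 0 j) * (f (c (I j) 0) - \sum_l y l * f (M (I j) l))).
  rewrite bE; under [\sum_l y l * f (bordered _ _ _ _)]eq_bigr do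
    rewrite bE mulrBr mulrCA mxE.
  rewrite sumrB -mulr_sumr; under [\sum_j f (v 0 j) * (_ - _)]eq_bigr do rewrite mulrBr.
  rewrite sumrB; set s1 := \sum_j f (v 0 j) * f _.
  have -> : \sum_l y l * (\sum_j f (v 0 j) * f (col l M (I j) 0)) =
      \sum_j f (v 0 j) * (\sum_l y l * f (M (I j) l)).
    rewrite (eq_bigr (fun l => \sum_j y l * (f (v 0 j) * f (col l M (I j) 0)))) => [|l _];
      last by rewrite mulr_sumr.
    rewrite exchange_big; apply: eq_bigr => j' _.
    by rewrite mulr_sumr; apply: eq_bigr => l _; rewrite [col _ _ _ _]mxE mulrCA.
  ring.
have TS (U : Type) (rr : seq U) (F : U -> S) : (forall i, T (F i)) -> T (\sum_(i <- rr) F i).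
  by move=> h; apply: (big_ind T).
apply: (TD); first by apply: TS => l; apply: (TM).
apply: (TD); first exact: TM.
by rewrite -mulN1r; apply: (TM); apply: TS => j; apply: (TM).
Qed.

End CramerModPrime.

(** * Solutions of the system from a vector field *)

Module Consistency. Import mpoly MPolyFacts.

Lemma idealB (R : comNzRingType) (I : R -> Prop) x y :
  is_ideal I -> I x -> I y -> I (x - y).
Proof. by move=> [_ ID IM] Ix Iy; rewrite -mulN1r; apply: ID => //; apply: IM. Qed.

Lemma ideal_sum (R : comNzRingType) (I : R -> Prop) (T : Type) (r : seq T) (P : pred T)
    (F : T -> R) :
  is_ideal I -> (forall i, P i -> I (F i)) -> I (\sum_(i <- r | P i) F i).
Proof. by move=> [I0 ID IM] h; apply: (big_ind I). Qed.

Lemma rdvd_is_ideal (R : comNzRingType) (q : R) : is_ideal (rdvd q).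
Proof. by split; [apply: rdvd0|apply: rdvdD|move=> r x; apply: rdvd_mull]. Qed.

Section Homog.
Variables (k : fieldType) (N D : nat).

(* [h ^ D * p (rho / h)], written without division. *)
Definition hom_eval (S : comNzRingType) (c : k -> S) (rho : 'I_N -> S) (h : S)
    (p : {mpoly k[N]}) : S :=
  \sum_(m <- msupp p) c p@_m * (\prod_i rho i ^+ m i) * h ^+ (D - mdeg m).

Lemma hom_eval_morph (S S' : comNzRingType) (f : {rmorphism S -> S'}) c c' rho h p :
  (forall x, f (c x) = c' x) ->
  f (hom_eval c rho h p) = hom_eval c' (f \o rho) (f h) p.
Proof.
move=> fc; rewrite rmorph_sum; apply: eq_bigr => m _.
rewrite !rmorphM rmorphXn /= fc rmorph_prod; congr (_ * _ * _).
by apply: eq_bigr => i _; rewrite rmorphXn.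
Qed.

Lemma dle_hom_eval s (rho : 'I_N -> {mpoly k[s]}) h p e : dle D p ->
  (forall i, dle e (rho i)) -> dle e h ->
  dle (D * e) (hom_eval (@mpolyC s k) rho h p).
Proof.
move=> hp hr hh; rewrite /hom_eval big_seq; apply: dle_sum => m hm.
have mD : (mdeg m <= D)%N by have := msize_mdeg_lt hm => /leq_trans/(_ hp).
rewrite -[in (D * e)%N](subnKC mD) mulnDl mdegE big_distrl /=.
apply: dleM; last exact: dleXn.
rewrite -[(\sum_i _)%N]add0n; apply: dleM; first exact: dleC.
by apply: (@dle_prod _ _ _ _ (fun i => m i * e)%N) => i; apply: dleXn.
Qed.

(** In each monomial of degree [e], a factor [h ^ e] turns every [zeta i] into [h * zeta i], which
    is [rho i] modulo [I]. *)
Lemma hom_eval_congr (S : comNzRingType) (c : k -> S) (I : S -> Prop) rho h zeta p :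
  is_ideal I -> dle D p -> (forall i, I (h * zeta i - rho i)) ->
  I (h ^+ D * mmap c zeta p - hom_eval c rho h p).
Proof.
move=> idI hp hI; have [I0 ID IM] := idI.
rewrite /mmap /hom_eval mulr_sumr -sumrB big_seq; apply: ideal_sum => // m hm.
have mD : (mdeg m <= D)%N by have := msize_mdeg_lt hm => /leq_trans/(_ hp).
have cM : forall a b a' b', I (a - a') -> I (b - b') -> I (a * b - a' * b').
  move=> a b a' b' Ia Ib; have -> : a * b - a' * b' = b * (a - a') + a' * (b - b') by ring.
  by apply: ID; apply: IM.
have hprod : I (\prod_i (h * zeta i) ^+ m i - \prod_i rho i ^+ m i).
  elim/big_rec2: _ => [|i x y _ Ixy]; first by rewrite subrr.
  apply: (cM) => //; elim: (m i) => [|l IH]; first by rewrite !expr0 subrr.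
  by rewrite !exprS; apply: (cM).
have E : h ^+ mdeg m * mmap1 zeta m = \prod_i (h * zeta i) ^+ m i.
  rewrite mdegE /mmap1 -prodrXr -big_split; apply: eq_bigr => i _.
  by rewrite exprMn.
rewrite -{1}(subnKC mD) exprD.
have -> : h ^+ mdeg m * h ^+ (D - mdeg m) * (c p@_m * mmap1 zeta m) -
    c p@_m * \prod_i rho i ^+ m i * h ^+ (D - mdeg m) =
  (c p@_m * h ^+ (D - mdeg m)) *
    (\prod_i (h * zeta i) ^+ m i - \prod_i rho i ^+ m i).
  by rewrite -E; ring.
exact: IM.
Qed.

End Homog.

Definition derivation (R : comNzRingType) (d : R -> R) :=
  (forall x y, d (x + y) = d x + d y) /\ (forall x y, d (x * y) = d x * y + x * d y).

(* [zeta] solves the system in the nonzero differential ring [B / J]; the variables outside the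
   image of [sigma] are not differentiated. *)
Definition consistent (k : fieldType) N n s (sigma : 'I_n -> 'I_N)
    (F : 'I_n -> {mpoly k[N]}) (G : 'I_s -> {mpoly k[N]}) :=
  exists (B : comNzRingType) (d : B -> B) (J : B -> Prop) (c : {rmorphism k -> B})
    (zeta : 'I_N -> B),
    [/\ derivation d, forall x, d (c x) = 0,
        [/\ is_ideal J, ~ J 1 & forall x, J x -> J (d x)],
        forall i, J (d (zeta (sigma i)) - mmap c zeta (F i)) &
        forall j, J (mmap c zeta (G j))].

Section LocalizedField.
Variables (R : idomainType) (delta : R -> R).
Hypothesis deltaP : derivation delta.
Variables (q h e : R).
Hypotheses (qP : rprime q) (qdelta : rdvd q (delta q)).
Hypotheses (qh : ~ rdvd q h) (qe : ~ rdvd q e).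

Let H := h * e.
Let eta : {poly R} := H%:P * 'X - 1.

Lemma derivation0 (S : comNzRingType) (d : S -> S) : derivation d -> d 0 = 0.
Proof.
by move=> [dD _]; apply: (addrI (d 0)); rewrite -dD !addr0.
Qed.

Lemma derivation1 (S : comNzRingType) (d : S -> S) : derivation d -> d 1 = 0.
Proof.
move=> [_ dM]; apply: (addrI (d 1)).
by rewrite addr0 -{3}[1]mulr1 dM mulr1 mul1r.
Qed.

(* The derivation [delta / e] on [R[1/(h e)]], where [X] stands for [1/(h e)]. *)
Definition loc_der (p : {poly R}) : {poly R} :=
  (h%:P * 'X) * map_poly delta p - ((h * delta H)%:P * 'X ^+ 3) * p^`().

Lemma loc_derivation : derivation loc_der.
Proof.
have [dD dM] := deltaP; have d0 := derivation0 deltaP.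
have mD x y : map_poly delta (x + y) = map_poly delta x + map_poly delta y.
  by apply/polyP => i; rewrite coefD !coef_map_id0 // coefD dD.
have mM x y : map_poly delta (x * y) = map_poly delta x * y + x * map_poly delta y.
  apply/polyP => i; rewrite coefD !coefM coef_map_id0 // coefM.
  rewrite (big_morph delta dD d0) -big_split; apply: eq_bigr => j _.
  by rewrite dM !coef_map_id0.
split=> x y; rewrite /loc_der ?mD ?mM ?derivD ?derivM; ring.
Qed.

Lemma loc_derC c : loc_der c%:P = (h * delta c)%:P * 'X.
Proof.
rewrite /loc_der derivC mulr0 subr0.
rewrite [map_poly _ _](_ : _ = (delta c)%:P) ?polyCM; first by ring.
apply/polyP => i; rewrite coef_map_id0 ?derivation0 // !coefC.
by case: eqP => //; rewrite derivation0.
Qed.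

Lemma loc_derX : loc_der 'X = - ((h * delta H)%:P * 'X ^+ 3).
Proof.
rewrite /loc_der derivX mulr1 [map_poly _ _](_ : _ = 0) ?mulr0 ?sub0r //.
apply/polyP => i; rewrite coef_map_id0 ?derivation0 // coefX coef0.
by case: eqP; rewrite ?derivation1 ?derivation0.
Qed.

(** The quotient of [{poly R}] by this ideal is [(R / q)[1 / H]], with ['X] as the inverse of
    [H]. *)
Definition loc_ideal (p : {poly R}) := exists a b, p = a * q%:P + b * eta.

Lemma loc_ideal_is_ideal : is_ideal loc_ideal.
Proof.
split; first by exists 0, 0; ring.
  by move=> _ _ [a [b ->]] [a' [b' ->]]; exists (a + a'), (b + b'); ring.
by move=> r _ [a [b ->]]; exists (r * a), (r * b); ring.
Qed.

Lemma loc_ideal_C r : rdvd q r -> loc_ideal r%:P.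
Proof. by move=> [w ->]; exists w%:P, 0; rewrite polyCM; ring. Qed.

Lemma loc_ideal_eta : loc_ideal eta.
Proof. by exists 0, 1; ring. Qed.

Lemma loc_ideal_der x : loc_ideal x -> loc_ideal (loc_der x).
Proof.
have [dD dM] := loc_derivation; move=> [a [b ->]]; rewrite dD !dM.
have [w Ew] := qdelta.
have -> : loc_der eta = - ((h * delta H)%:P * 'X ^+ 2) * eta.
  rewrite /eta dD dM loc_derC loc_derX (_ : loc_der (-1) = 0).
    by rewrite !polyCM; ring.
  have d1 := derivation1 deltaP; have [dD' _] := deltaP.
  rewrite -polyCN loc_derC (_ : delta (-1) = 0) ?mulr0 ?mul0r //.
  by apply: (addrI (delta 1)); rewrite -dD' subrr derivation0 // d1 addr0.
rewrite loc_derC Ew.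
exists (loc_der a + a * (h * w)%:P * 'X), (loc_der b - b * ((h * delta H)%:P * 'X ^+ 2)).
by rewrite !polyCM; ring.
Qed.

Lemma clear_denominator (a : {poly R}) : exists M r c,
  (H ^+ M)%:P * a = r%:P + c * eta.
Proof.
elim/poly_ind: a => [|a x [M [r [c E]]]]; first by exists 0%N, 0, 0; ring.
exists M.+1, (r + H ^+ M.+1 * x), (r%:P + c * H%:P * 'X).
have -> : (H ^+ M.+1)%:P * (a * 'X + x%:P) =
  ((H ^+ M)%:P * a) * (H%:P * 'X) + (H ^+ M.+1 * x)%:P by rewrite exprS !polyCM; ring.
by rewrite E polyCD /eta; ring.
Qed.

(** After clearing denominators, a constant [H ^+ M - r * q] is a multiple of [eta], which has
    degree 1 in ['X]. That constant is therefore 0 and [q] divides a power of [H], contrary to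
    primality. *)
Lemma loc_ideal1 : ~ loc_ideal 1.
Proof.
have [q0 q1 qq] := qP.
move=> [a [b E]]; have [M [r [c Ea]]] := clear_denominator a.
have qHM : ~ rdvd q (H ^+ M) by move/(rdvd_prime_exp qP)/qq => [].
have E1 : (H ^+ M - r * q)%:P = ((H ^+ M)%:P * b + c * q%:P) * eta.
  rewrite polyCB polyCM -[(H ^+ M)%:P in LHS]mulr1 {1}E.
  have -> : r%:P = (H ^+ M)%:P * a - c * eta by rewrite Ea; ring.
  ring.
have H0 : H != 0.
  by apply/eqP => H0; have /qq[] : rdvd q H by rewrite H0; apply: rdvd0.
have seta : size eta = 2%N.
  by rewrite /eta -polyCN size_MXaddC polyC_eq0 (negPf H0) size_polyC H0.
have [w0|w0] := eqVneq ((H ^+ M)%:P * b + c * q%:P) 0.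
  apply: qHM; exists r; apply/eqP; rewrite -subr_eq0 -polyC_eq0 E1 w0.
  by rewrite mul0r.
have := congr1 (fun f : {poly R} => size f) E1.
rewrite size_polyC size_mul ?seta //; last by rewrite -size_poly_gt0 seta.
move: w0; rewrite -size_poly_gt0; case: (size _) => //= l _.
by rewrite addnC /=; case: (_ != 0).
Qed.

Lemma loc_ideal_cancel x y : loc_ideal (H%:P * 'X * x - y) -> loc_ideal y -> loc_ideal x.
Proof.
have [_ JD JM] := loc_ideal_is_ideal; move=> J1 J2.
have -> : x = (H%:P * 'X * x - y) + y + (- x) * eta by rewrite /eta; ring.
by apply: (JD); [apply: (JD)|apply: JM; apply: loc_ideal_eta].
Qed.

Lemma loc_ideal_cancelH x : loc_ideal (H%:P * x) -> loc_ideal x.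
Proof.
have idJ := loc_ideal_is_ideal; have [J0 JD JM] := idJ; move=> J1.
apply: (@loc_ideal_cancel _ ('X * (H%:P * x))); last exact: JM.
by rewrite (_ : _ - _ = 0) //; ring.
Qed.

Lemma loc_ideal_cancelh l x : loc_ideal (h%:P ^+ l * x) -> loc_ideal x.
Proof.
have [J0 JD JM] := loc_ideal_is_ideal.
elim: l => [|l IH]; first by rewrite expr0 mul1r.
move=> Jx; apply: IH; apply: loc_ideal_cancelH.
have -> : H%:P * (h%:P ^+ l * x) = e%:P * (h%:P ^+ l.+1 * x).
  by rewrite /H polyCM exprS; ring.
exact: JM.
Qed.

Lemma loc_ideal_cancele x : loc_ideal (e%:P * x) -> loc_ideal x.
Proof.
have [J0 JD JM] := loc_ideal_is_ideal.
move=> Jx; apply: loc_ideal_cancelH.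
by rewrite /H polyCM -mulrA; apply: JM.
Qed.

(** The first divisibility by [q] is [delta (rho / h) = e * F (rho / h)] multiplied by
    [h ^ (D + 2)]. The derivation [delta / e] of the localisation therefore has [rho / h] as a
    solution. *)
Theorem vector_field_consistent (k : fieldType) N n s (sigma : 'I_n -> 'I_N)
    (F : 'I_n -> {mpoly k[N]}) (G : 'I_s -> {mpoly k[N]}) (D : nat)
    (c : {rmorphism k -> R}) (rho : 'I_N -> R) :
  (forall x, delta (c x) = 0) ->
  (forall i, dle D (F i)) -> (forall j, dle D (G j)) ->
  (forall i, rdvd q (h ^+ D * (h * delta (rho (sigma i)) - rho (sigma i) * delta h)
     - e * (h ^+ 2 * hom_eval D c rho h (F i)))) ->
  (forall j, rdvd q (hom_eval D c rho h (G j))) ->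
  consistent sigma F G.
Proof.
(* Modulo [eta], [e * 'X] is [1 / h], so [zeta i] represents [rho i / h]. *)
move=> dc dF dG hF hG; pose zeta i := (rho i * e)%:P * 'X : {poly R}.
pose c' : {rmorphism k -> {poly R}} := polyC \o c.
have idJ := loc_ideal_is_ideal; have [J0 JD JM] := idJ.
have Jalpha i : loc_ideal (h%:P * zeta i - (rho i)%:P).
  have -> : h%:P * zeta i - (rho i)%:P = (rho i)%:P * eta.
    by rewrite /zeta /eta /H !polyCM; ring.
  by apply: JM; apply: loc_ideal_eta.
have homogC p : hom_eval D c' (polyC \o rho) h%:P p = (hom_eval D c rho h p)%:P.
  by rewrite (hom_eval_morph D (f := polyC) (c' := c')).
have Jhom p : dle D p ->
    loc_ideal (h%:P ^+ D * mmap c' zeta p - (hom_eval D c rho h p)%:P).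
  by move=> dp; rewrite -homogC; apply: hom_eval_congr.
exists {poly R}, loc_der, loc_ideal, c', zeta; split.
- exact: loc_derivation.
- by move=> x; rewrite loc_derC dc mulr0 mul0r.
- by split=> //; [apply: loc_ideal1|apply: loc_ideal_der].
- move=> i; set t := _ - _; apply: (@loc_ideal_cancelh D.+2); apply: loc_ideal_cancele.
  set r := rho (sigma i); set z := zeta (sigma i) in t *.
  pose alpha := h%:P * z - r%:P.
  have [dD dM] := loc_derivation.
  have Ealpha : loc_der alpha = (h * delta h)%:P * 'X * z + h%:P * loc_der z
       - (h * delta r)%:P * 'X.
    have dB x y : loc_der (x - y) = loc_der x - loc_der y.
      by apply: (addIr (loc_der y)); rewrite -dD !subrK.
    by rewrite dB dM !loc_derC; ring.
  have [w Ew] := hF i; rewrite -/r in Ew.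
  have Ek : loc_ideal (h%:P ^+ D * (h%:P * (delta r)%:P - r%:P * (delta h)%:P)
     - e%:P * (h%:P ^+ 2 * (hom_eval D c rho h (F i))%:P)).
    move: (loc_ideal_C (hF i)); rewrite -/r.
    by rewrite !(polyCM, polyCB, polyCN, rmorphXn).
  have Ja : loc_ideal alpha := Jalpha (sigma i).
  have Jda := loc_ideal_der Ja; rewrite Ealpha in Jda.
  move: (hom_eval D c rho h (F i)) (Jhom _ (dF i)) Ek => f Jf Ek.
  move: (mmap c' zeta (F i)) Jf @t => Ft Jf t.
  move: Jda Ja Ek Jf; rewrite /t /alpha; set dz := loc_der z.
  rewrite !polyCM; set hP := h%:P; set dh := (delta h)%:P; set dr := (delta r)%:P.
  set eP := e%:P; set rP := r%:P; set fP := f%:P; move=> Jda Ja Ek Jf.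
  (* Each term on the right contains an element of the ideal: the derivative of [alpha], [alpha]
     itself, the hypothesis on [F], [eta], and the congruence between [F (zeta)] and its
     homogenisation. *)
  have -> : eP * (hP ^+ D.+2 * (dz - Ft)) =
     eP * hP ^+ D.+1 * (hP * dh * 'X * z + hP * dz - hP * dr * 'X)
     - hP * eP * 'X * hP ^+ D * dh * (hP * z - rP)
     + hP * eP * 'X * (hP ^+ D * (hP * dr - rP * dh) - eP * (hP ^+ 2 * fP))
     + eP * (hP ^+ 2 * fP) * eta
     - eP * hP ^+ 2 * (hP ^+ D * Ft - fP).
    by rewrite /eta /H polyCM -/hP -/eP !exprS; ring.
  apply: idealB => //; last exact: JM.
  apply: (JD); last by apply: JM; apply: loc_ideal_eta.
  apply: (JD); last exact: JM.
  by apply: idealB => //; apply: JM.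
- move=> j; apply: (@loc_ideal_cancelh D).
  rewrite -[_ * _](subrK (hom_eval D c rho h (G j))%:P).
  by apply: (JD); [apply: Jhom|apply: loc_ideal_C].
Qed.

End LocalizedField.
End Consistency.

Module JetLift. Import mpoly MPolyFacts Consistency.

Lemma sum_derivation (R : comNzRingType) b (pd : 'I_b -> R -> R) (Y : 'I_b -> R) :
  (forall l, derivation (pd l)) -> derivation (fun p => \sum_l Y l * pd l p).
Proof.
move=> h; split=> x y.
  by rewrite -big_split; apply: eq_bigr => l _; have [hD _] := h l; rewrite hD mulrDr.
rewrite mulr_suml mulr_sumr -big_split; apply: eq_bigr => l _ /=.
by have [_ hM] := h l; rewrite hM; ring.
Qed.

Section VectorField.
Variables (k : fieldType) (N n s : nat) (sigma : 'I_n -> 'I_N).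
Variables (F : 'I_n -> {mpoly k[N]}) (G : 'I_s -> {mpoly k[N]}) (D : nat).
Variables (R : idomainType) (b : nat) (pd : 'I_b -> R -> R) (c : {rmorphism k -> R}).
Variables (q h : R) (rho : 'I_N -> R).

(* The unknown is a derivation [sum_l Y_l pd_l]: row 0 asks it to preserve [q], row [i + 1] to send
   [rho_(sigma i) / h] to [F_i (rho / h)], after multiplication by [h ^ (D + 2)]. *)
Definition vf_matrix : 'M[R]_(n.+1, b) := \matrix_(i, l)
  if unlift ord0 i is Some i' then
    h ^+ D * (h * pd l (rho (sigma i')) - rho (sigma i') * pd l h)
  else pd l q.

Definition vf_rhs : 'cV[R]_n.+1 := \col_i
  if unlift ord0 i is Some i' then h ^+ 2 * hom_eval D c rho h (F i') else 0.

Variables (ev : {rmorphism R -> {poly k}}) (y : 'I_b -> {poly k}) (A K : nat).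
Variable z : 'I_N -> {poly k}.

(** The velocities [y] of the jet solve the linear system to high order, so the bordered minors
    vanish along the jet and are divisible by [q]. Cramer's rule modulo [q] then yields the vector
    field. *)
Theorem jet_vector_field :
  (forall l, derivation (pd l)) -> (forall l x, pd l (c x) = 0) ->
  (forall x, ev (c x) = x%:P) ->
  (forall p, (ev p)^`() = \sum_l y l * ev (pd l p)) ->
  rprime q -> ~ rdvd q h -> (2 * A <= K)%N ->
  (forall i, dle D (F i)) -> (forall j, dle D (G j)) ->
  rdvd 'X^(2 * A) (ev q) ->
  (forall i, rdvd 'X^(2 * A) (ev h * z i - ev (rho i))) ->
  (forall i, rdvd 'X^K ((z (sigma i))^`() - mmap polyC z (F i))) ->
  (forall j, rdvd 'X^K (mmap polyC z (G j))) ->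
  (forall j, rdvd 'X^(2 * A) (ev (hom_eval D c rho h (G j))) ->
     rdvd q (hom_eval D c rho h (G j))) ->
  (forall r (I : 'I_r -> 'I_n.+1) (J : 'I_r -> 'I_b) i0, (r <= n.+1)%N ->
     rdvd 'X^((2 * A).-1) (ev (bordered vf_matrix I J i0 vf_rhs)) ->
     rdvd q (bordered vf_matrix I J i0 vf_rhs)) ->
  consistent sigma F G.
Proof.
move=> pdP pdc evc chain qP qh AK dF dG evq evz jetF jetG small_G small_b.
have idA j := rdvd_is_ideal ('X^j : {poly k}).
have homE p : ev (hom_eval D c rho h p) = hom_eval D polyC (ev \o rho) (ev h) p.
  exact: hom_eval_morph.
have homJ p : dle D p ->
    rdvd 'X^(2 * A) (ev h ^+ D * mmap polyC z p - ev (hom_eval D c rho h p)).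
  by move=> dp; rewrite homE; apply: hom_eval_congr.
have hG j : rdvd q (hom_eval D c rho h (G j)).
  apply: small_G; have := homJ _ (dG j); set a := _ * _; set x := ev _ => E.
  have -> : x = a - (a - x) by ring.
  apply: rdvdB => //; apply: rdvd_mull; exact: rdvdXn_le AK (jetG j).
have low (x : {poly k}) : rdvd 'X^(2 * A) x -> rdvd 'X^((2 * A).-1) x.
  by apply: rdvdXn_le (leq_pred _).
(* One order is lost by differentiating the congruences modulo ['X^(2 * A)] for [q] and for
   [h * z - rho]. *)
have row i : rdvd 'X^((2 * A).-1)
    (ev (vf_rhs i 0) - \sum_l y l * ev (vf_matrix i l)).
  rewrite mxE; under eq_bigr do rewrite mxE.
  case: (unliftP ord0 i) => [i' _|_]; last first.
    rewrite rmorph0 sub0r -chain; exact/rdvdN/rdvdXn_deriv.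
  set r := rho (sigma i').
  have -> : \sum_l y l * ev (h ^+ D * (h * pd l r - r * pd l h)) =
      ev h ^+ D * (ev h * (ev r)^`() - ev r * (ev h)^`()).
    rewrite !chain !mulr_sumr -sumrB mulr_sumr; apply: eq_bigr => l _.
    by rewrite !(rmorphM, rmorphB, rmorphXn) /=; ring.
  have Ez := evz (sigma i'); rewrite -/r in Ez.
  have Edz := rdvdXn_deriv Ez; move: Edz; rewrite derivB derivM => Edz.
  have Ehom := homJ _ (dF i').
  have EF := rdvdXn_le AK (jetF i').
  rewrite rmorphM rmorphXn /=.
  move: (ev (hom_eval _ _ _ _ _)) Ehom => f Ehom.
  move: (mmap polyC z (F i')) Ehom EF => Fz Ehom EF.
  move: (z (sigma i')) Ez Edz EF => zi Ez Edz EF.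
  move: (ev h) (ev r) Ez Edz Ehom => hh rr Ez Edz Ehom.
  move: (zi^`()) (hh^`()) (rr^`()) Edz EF => dz dh dr Edz EF.
  have -> : hh ^+ 2 * f - hh ^+ D * (hh * dr - rr * dh) =
     hh ^+ D.+1 * (dh * zi + hh * dz - dr) - hh ^+ D * dh * (hh * zi - rr)
     - hh ^+ 2 * (hh ^+ D * Fz - f) - hh ^+ D.+2 * (dz - Fz).
    by rewrite !exprS; ring.
  apply: rdvdB; last by apply: rdvd_mull; apply: low.
  apply: rdvdB; last by apply: rdvd_mull; apply: low.
  apply: rdvdB; first exact: rdvd_mull.
  by apply: rdvd_mull; apply: low.
have [|Y [e [qe hY]]] := solve_mod_prime qP (M := vf_matrix) (c := vf_rhs).
  (* Multiples of [q] vanish along the jet because [q] does; this covers the minors bordered by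
     columns of the matrix. *)
  move=> r I J i0 rn hl; apply: small_b => //.
  apply: (bordered_eval (idA _) row) => l.
  have [w ->] := hl l; rewrite rmorphM; apply: rdvd_mull; exact: low.
pose delta p := \sum_l Y l 0 * pd l p.
have deltaP : derivation delta := sum_derivation (fun l => Y l 0) pdP.
apply: (vector_field_consistent deltaP qP _ qh qe _ dF dG _ hG).
- have := hY ord0; rewrite !mxE unlift_none mulr0 subr0 => h0.
  rewrite /delta; move: h0; congr (rdvd q _); apply: eq_bigr => l _.
  by rewrite mxE unlift_none mulrC.
- by move=> x; rewrite /delta big1 // => l _; rewrite pdc mulr0.
- move=> i; have := hY (lift ord0 i); rewrite !mxE liftK.
  congr (rdvd q (_ - _)); rewrite /delta !mulr_sumr -sumrB mulr_sumr.
  by apply: eq_bigr => l _; rewrite mxE liftK; ring.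
Qed.

End VectorField.
End JetLift.

(** * Evaluation at power series and linear forms in the jet *)

Module GenericPoint. Import mpoly MPolyFacts Consistency.

Definition ext (T : Type) s (w : 'I_s -> T) (t : T) (i : 'I_s.+1) : T :=
  if unlift ord_max i is Some j then w j else t.

Lemma ext_max (T : Type) s (w : 'I_s -> T) t : ext w t ord_max = t.
Proof. by rewrite /ext unlift_none. Qed.

Lemma ext_widen (T : Type) s (w : 'I_s -> T) t (j : 'I_s) :
  ext w t (widen_ord (leqnSn s) j) = w j.
Proof.
rewrite /ext (_ : widen_ord _ j = lift ord_max j) ?liftK //.
by apply: val_inj; rewrite /= /bump leqNgt ltn_ord.
Qed.

Section Evaluation.
Variables (k : fieldType) (s : nat).
Local Notation ev w := (mmap (@polyC k) w).

Lemma ev_mwiden (w : 'I_s -> {poly k}) t (r : {mpoly k[s]}) :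
  ev (ext w t) (mwiden r) = ev w r.
Proof.
apply: (mpoly_morph_eq (f := ev (ext w t) \o @mwiden s k) (g := ev w)) => [c|i] /=.
  by rewrite mwidenC !mmapC.
by rewrite mwiden_var !mmapX !mmap1U ext_widen.
Qed.

Definition ev2 (w : 'I_s -> {poly k}) t (p : {poly {mpoly k[s]}}) : {poly k} :=
  (map_poly (ev w) p).[t].

Lemma ev_muni (w : 'I_s -> {poly k}) t (p : {mpoly k[s.+1]}) :
  ev (ext w t) p = ev2 w t (muni p).
Proof.
pose g : {rmorphism {poly {mpoly k[s]}} -> {poly k}} :=
  horner_eval t \o map_poly (ev w).
apply: (mpoly_morph_eq (f := ev (ext w t)) (g := g \o @muni s k)) => [c|] /=.
  by rewrite /horner_eval muniC map_polyC hornerC /= !mmapC.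
apply: ord_widen_max => [i|]; rewrite /horner_eval.
  by rewrite muni_var map_polyC hornerC /= !mmapX !mmap1U ext_widen.
by rewrite muni_last map_polyX hornerX /= !mmapX !mmap1U ext_max.
Qed.

Lemma ev_munin (w : 'I_s -> {poly k}) t p : ev (ext w t) (munin p) = ev2 w t p.
Proof. by rewrite ev_muni muninK. Qed.

End Evaluation.

Lemma ev_deriv (k : fieldType) s (w : 'I_s -> {poly k}) (p : {mpoly k[s]}) :
  (mmap polyC w p)^`() = \sum_l (w l)^`() * mmap polyC w p^`M(l).
Proof.
elim/mpolyind: p => [|c m p _ _ IH].
  by rewrite mmap0 deriv0 big1 // => l _; rewrite mderiv0 mmap0 mulr0.
rewrite mmapD derivD IH; under [RHS]eq_bigr do rewrite mderivD mmapD mulrDr.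
rewrite big_split; congr (_ + _) => {IH p}.
rewrite mmapZ mmapX mul_polyC derivZ -mul_polyC.
have dX (x : {poly k}) e : (x ^+ e)^`() = x^`() * (e%:R%:P * x ^+ e.-1).
  by rewrite deriv_exp -mulr_natl polyC_natr mulrCA.
have main : forall (r : seq 'I_s) (e : 'I_s -> nat), uniq r ->
   (\prod_(i <- r) w i ^+ e i)^`() = \sum_(l <- r) (w l)^`() *
     ((e l)%:R%:P * \prod_(i <- r) w i ^+ (e i - (l == i)))%R.
  move=> r e; elim: r => [|a r IH] /=; first by rewrite !big_nil derivC.
  move=> /andP[ar ur]; rewrite !big_cons derivM dX IH // eqxx subn1.
  congr (_ + _).
    have -> : \prod_(j <- r) w j ^+ (e j - (a == j)) = \prod_(j <- r) w j ^+ e j.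
      apply: eq_big_seq => i ir.
      by rewrite (_ : a == i = false) ?subn0 //; apply: contraNF ar => /eqP->.
    ring.
  rewrite mulr_sumr; apply: eq_big_seq => l lr; rewrite big_cons.
  rewrite (_ : l == a = false) ?subn0; first by ring.
  by apply: contraNF ar => /eqP<-.
rewrite /mmap1 main ?index_enum_uniq // mulr_sumr; apply: eq_bigr => l _.
rewrite mderivZ mderivX !mmapZ mmapX /mmap1.
rewrite polyC_natr -[(m l)%:R]polyC_natr.
rewrite (eq_bigr (fun i => w i ^+ (m - U_(l))%MM i)) => [|i _].
  by rewrite polyC_natr; ring.
by rewrite mnmBE mnm1E.
Qed.

Section Expansion.
Variables (k : fieldType) (s e r : nat).
Variables (w : 'I_s -> {poly k}) (t : {poly k}).
Local Notation ev w := (mmap (@polyC k) w).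
Local Notation idx := ('X_{1..s < e.+1} * 'I_r)%type.

Lemma ev_expand (p : {mpoly k[s]}) : dle e p ->
  ev w p = \sum_(m : 'X_{1..s < e.+1}) p@_m *: ev w 'X_[m].
Proof.
move=> dp; rewrite {1}(mpolywE dp) raddf_sum; apply: eq_bigr => m _.
by rewrite /= mmapZ mul_polyC.
Qed.

Lemma ev2_wide (p : {poly {mpoly k[s]}}) : (size p <= r)%N ->
  ev2 w t p = \sum_(l < r) ev w p`_l * t ^+ l.
Proof.
move=> sp; rewrite /ev2 (horner_coef_wide _ (n := r)).
  by apply: eq_bigr => l _; rewrite coef_map.
exact: leq_trans (size_poly _ _) sp.
Qed.

Lemma ev2_deriv_wide (p : {poly {mpoly k[s]}}) : (size p <= r)%N ->
  ev2 w t p^`() = \sum_(l < r) ev w p`_l * (t ^+ l.-1 *+ l).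
Proof.
move=> sp; rewrite /ev2 -deriv_map; set P := map_poly _ _.
have -> : P = \sum_(l < r) P`_l *: 'X^l.
  rewrite -poly_def; apply/polyP => i; rewrite coef_poly; case: ltnP => // ri.
  by rewrite nth_default // (leq_trans (size_poly _ _)) // (leq_trans sp).
rewrite raddf_sum horner_sum; apply: eq_bigr => l _.
by rewrite /= derivZ derivXn hornerZ hornerMn hornerXn coef_map.
Qed.

Lemma ev2_expand (p : {poly {mpoly k[s]}}) : (size p <= r)%N -> (forall l, dle e p`_l) ->
  ev2 w t p = \sum_(j : idx) (p`_(j.2))@_(j.1) *: (ev w 'X_[j.1] * t ^+ j.2).
Proof.
move=> sp dp; rewrite ev2_wide // -(pair_bigA _ (fun (m : 'X_{1..s < e.+1}) (l : 'I_r) =>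
  (p`_l)@_m *: (ev w 'X_[m] * t ^+ l))) /= exchange_big; apply: eq_bigr => l _.
rewrite (ev_expand (dp l)) mulr_suml; apply: eq_bigr => m _.
by rewrite scalerAl.
Qed.

Lemma ev2_deriv_expand (p : {poly {mpoly k[s]}}) :
  (size p <= r)%N -> (forall l, dle e p`_l) ->
  ev2 w t p^`() =
  \sum_(j : idx) (p`_(j.2))@_(j.1) *: (ev w 'X_[j.1] * (t ^+ (j.2).-1 *+ j.2)).
Proof.
move=> sp dp; rewrite ev2_deriv_wide // -(pair_bigA _ (fun (m : 'X_{1..s < e.+1}) (l : 'I_r) =>
  (p`_l)@_m *: (ev w 'X_[m] * (t ^+ l.-1 *+ l)))) /= exchange_big; apply: eq_bigr => l _.
rewrite (ev_expand (dp l)) mulr_suml; apply: eq_bigr => m _.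
by rewrite scalerAl.
Qed.

(** Converts the coefficient families produced by [perturbed_relation] back into polynomials of
    controlled degree. *)
Lemma poly_of_coefs (a : idx -> k) : exists p : {poly {mpoly k[s]}},
  [/\ (size p <= r)%N, forall l, dle e p`_l & forall j : idx, (p`_(j.2))@_(j.1) = a j].
Proof.
pose a' (m : 'X_{1..s < e.+1}) l := if insub l is Some l' then a (m, l') else 0.
pose c l : {mpoly k[s]} := \sum_(m : 'X_{1..s < e.+1}) a' m l *: 'X_[m].
have dc l : dle e (c l).
  apply: dle_sum => m _; apply: dleZ; rewrite /dle msizeX; exact: bmdeg.
exists (\poly_(l < r) c l); split.
- exact: size_poly.
- by move=> l; rewrite coef_poly; case: ifP => // _; apply: dle0.
- move=> [m l] /=; rewrite coef_poly ltn_ord /c raddf_sum (bigD1 m) //=.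
  rewrite mcoeffZ mcoeffX eqxx mulr1 /a' valK big1 ?addr0 // => m' ne.
  by rewrite mcoeffZ mcoeffX val_eqE (negPf ne) mulr0.
Qed.

End Expansion.

Section Lin.
Variables (k : fieldType) (N : nat) (z : 'I_N -> {poly k}).

Definition lin (a : {poly k}) := exists c : 'I_N -> k, a = \sum_j c j *: z j.

Lemma lin_var j : lin (z j).
Proof.
exists (fun i => (i == j)%:R); rewrite (bigD1 j) //= eqxx scale1r big1 ?addr0 // => i ij.
by rewrite (negPf ij) scale0r.
Qed.

Lemma linD a b : lin a -> lin b -> lin (a + b).
Proof.
move=> [c ->] [d ->]; exists (fun i => c i + d i); rewrite -big_split.
by apply: eq_bigr => i _; rewrite scalerDl.
Qed.

Lemma linZ x a : lin a -> lin (x *: a).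
Proof.
move=> [c ->]; exists (fun i => x * c i); rewrite scaler_sumr.
by apply: eq_bigr => i _; rewrite scalerA.
Qed.

Lemma lin_ext s (w : 'I_s -> {poly k}) t :
  (forall i, lin (w i)) -> lin t -> forall i, lin (ext w t i).
Proof. by move=> hw ht i; rewrite /ext; case: unlift. Qed.

(** Substituting linear forms does not raise the degree, so the gap for polynomials in [z] also
    holds for polynomials in [w]. *)
Lemma lin_substitution s (w : 'I_s -> {poly k}) (p : {mpoly k[s]}) e :
  (forall i, lin (w i)) -> dle e p ->
  exists2 P : {mpoly k[N]}, dle e P & mmap polyC z P = mmap polyC w p.
Proof.
move=> /boolp.choice[c hc] dp.
pose lq := [tuple \sum_j c i j *: 'X_j | i < s] : s.-tuple {mpoly k[N]}.
exists (p \mPo lq).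
  rewrite comp_mpolyE big_seq; apply: dle_sum => m hm; apply: dleZ.
  apply: (@dle_le _ _ (mdeg m)).
    by have := msize_mdeg_lt hm => /leq_trans/(_ dp).
  rewrite mdegE; apply: (@dle_prod _ _ _ _ (fun i => m i)) => i.
  rewrite -[X in dle X]muln1; apply: dleXn; rewrite tnth_mktuple.
  by apply: dle_sum => j _; apply/dleZ/dleX.
pose f : {rmorphism {mpoly k[s]} -> {poly k}} := mmap polyC z \o (fun x => x \mPo lq).
apply: (mpoly_morph_eq (f := f) (g := mmap polyC w)) => [x|i] /=.
  by rewrite comp_mpolyC !mmapC.
rewrite comp_mpolyXU -tnth_nth tnth_mktuple mmapX mmap1U hc.
rewrite raddf_sum; apply: eq_bigr => j _.
by rewrite /= mmapZ mmapX mmap1U mul_polyC.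
Qed.

End Lin.
End GenericPoint.

Section Perturbation.
Variable k : fieldType.
Hypothesis ch0 : [pchar k] =i pred0.

Lemma horner_coefp i (p : {poly {poly k}}) x :
  (map_poly (coefp i) p).[x] = (p.[x%:P])`_i.
Proof.
rewrite horner_poly horner_coef coef_sum; apply: eq_bigr => l _.
by rewrite -polyC_exp coefMC.
Qed.

(* The relations of [t + x *: zeta] can be chosen polynomial in [x]; [a0] and [a1] are their
   coefficients of degree 0 and 1 in [x]. *)
Lemma perturbed_relation (J : finType) (mon : J -> {poly k}) (ex : J -> nat) B
    (t zeta : {poly k}) :
  (forall x : k, exists u : J -> k, (exists j, u j != 0) /\
     rdvd 'X^B (\sum_j u j *: (mon j * (t + x *: zeta) ^+ ex j))) ->
  exists a0 a1 : J -> k, [/\ exists j, a0 j != 0,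
    rdvd 'X^B (\sum_j a0 j *: (mon j * t ^+ ex j)) &
    rdvd 'X^B (\sum_j a0 j *: (mon j * (t ^+ (ex j).-1 *+ ex j)) * zeta +
               \sum_j a1 j *: (mon j * t ^+ ex j))].
Proof.
move=> h.
pose P j : {poly {poly k}} := (mon j)%:P * (t%:P + zeta%:P * 'X) ^+ ex j.
have Px j x : (P j).[x%:P] = mon j * (t + x *: zeta) ^+ ex j.
  by rewrite /P !(hornerE, horner_exp) -mul_polyC [zeta * _]mulrC.
have P0 j : (P j)`_0 = mon j * t ^+ ex j.
  by rewrite -horner_coef0 -polyC0 Px scale0r addr0.
have P1 j : (P j)`_1 = mon j * (t ^+ (ex j).-1 *+ ex j) * zeta.
  have := coef_deriv (P j) 0; rewrite mulr1n => <-.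
  rewrite -horner_coef0 /P derivM derivC mul0r add0r deriv_exp derivD derivC add0r.
  rewrite derivM derivC mul0r add0r derivX mulr1 !(hornerE, horner_exp, hornerMn).
  rewrite -mulrA; congr (_ * _); rewrite ?mulr0 ?addr0.
  by rewrite mulrnAl mulrC.
(* The entries are polynomials in the deformation parameter [x]; the kernel of [M] at [x] consists
   of the relations of [t + x *: zeta] modulo ['X^B]. *)
pose M : 'M[{poly k}]_(#|J|, B) := \matrix_(a, i) map_poly (coefp i) (P (enum_val a)).
have reind (a : 'I_#|J| -> {poly k}) (f : J -> {poly k} -> {poly k}) :
    \sum_j f j (a (enum_rank j)) = \sum_i f (enum_val i) (a i).
  rewrite (reindex (@enum_val _ J)) /=; last first.
    by exists enum_rank => x _; rewrite ?enum_valK ?enum_rankK.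
  by apply: eq_bigr => i _; rewrite enum_valK.
have [x|b bM b0] := kernel_family (M := M) ch0.
  have [u [[j0 uj0] /rdvdXnP hu]] := h x; exists (\row_a u (enum_val a)).
    apply: contraNneq uj0 => E; have := congr1 (fun v : 'rV_ _ => v 0 (enum_rank j0)) E.
    by rewrite !mxE enum_rankK => ->.
  apply/rowP => i; rewrite !mxE -[RHS](hu i) // coef_sum.
  rewrite (reindex (@enum_val _ J)) /=; last first.
    by exists enum_rank => y _; rewrite ?enum_valK ?enum_rankK.
  apply: eq_bigr => a _; rewrite !mxE coefZ -Px; congr (_ * _).
  by rewrite /horner_eval horner_coefp.
have coefM0 (j : J) i : (map_poly (coefp i) (P j))`_0 = (mon j * t ^+ ex j)`_i.
  by rewrite coef_map /= P0.
have coefM1 (j : J) i : (map_poly (coefp i) (P j))`_1 =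
    (mon j * (t ^+ (ex j).-1 *+ ex j) * zeta)`_i.
  by rewrite coef_map /= P1.
have entry (i : 'I_B) : \sum_j b 0 (enum_rank j) * map_poly (coefp i) (P j) = 0.
  have := congr1 (fun v : 'rV_B => v 0 i) bM; rewrite !mxE => E; rewrite -[RHS]E.
  apply: (etrans (reind (b 0) (fun j f => f * map_poly (coefp i) (P j)))).
  by apply: eq_bigr => a _; rewrite mxE.
exists (fun j => (b 0 (enum_rank j))`_0), (fun j => (b 0 (enum_rank j))`_1); split.
- have [a ba] : exists a, (b 0 a)`_0 != 0.
    apply/existsP; apply: contraNT b0; rewrite negb_exists => /forallP b0.
    apply/eqP/rowP => a; rewrite !mxE /horner_eval horner_coef0.
    by apply/eqP; rewrite -[_ == _]negbK b0.
  by exists (enum_val a); rewrite enum_valK.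
- apply/rdvdXnP => i iB; rewrite coef_sum.
  have := congr1 (fun f : {poly k} => f`_0) (entry (Ordinal iB)).
  rewrite coef0 coef_sum => E; rewrite -[RHS]E; apply: eq_bigr => j _.
  by rewrite coef0M coefZ coefM0.
(* The coefficient of [x] in [b_j * P_j] is [a0 j] times that of the deformed power plus [a1 j]
   times the undeformed power. *)
- apply/rdvdXnP => i iB.
  have := congr1 (fun f : {poly k} => f`_1) (entry (Ordinal iB)).
  rewrite coef0 coef_sum => E; rewrite -[RHS]E coefD !coef_sum -big_split.
  apply: eq_bigr => j _ /=.
  rewrite [RHS]coefM 2!big_ord_recr big_ord0 /= add0r subn0 subnn coefM1 coefM0.
  by rewrite -scalerAl !coefZ.
Qed.

End Perturbation.

(** * Reduction of a jet to a hypersurface *)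

Module Core. Import mpoly MPolyFacts Consistency JetLift GenericPoint.

Section Jet.
Variables (k : fieldType) (N : nat) (z : 'I_N -> {poly k}) (A d : nat).
Hypothesis ch0 : [pchar k] =i pred0.
Hypothesis A0 : (0 < A)%N.
Hypothesis gap : forall p : {mpoly k[N]}, dle d p ->
  rdvd 'X^A (mmap polyC z p) -> rdvd 'X^(2 * A) (mmap polyC z p).

Local Notation ev w := (mmap (@polyC k) w).
Definition null (a : {poly k}) := rdvd 'X^(2 * A) a.

Lemma null_low a : null a -> rdvd 'X^((2 * A).-1) a.
Proof. exact: rdvdXn_le (leq_pred _). Qed.

Section Forms.
Variables (s : nat) (w : 'I_s -> {poly k}).
Hypothesis linw : forall i, lin z (w i).
Implicit Types p : {mpoly k[s]}.

Lemma gap_forms p j : dle d p -> (A <= j)%N -> rdvd 'X^j (ev w p) -> null (ev w p).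
Proof.
move=> dp Aj h; have [P dP E] := lin_substitution linw dp.
by rewrite /null -E; apply: gap => //; rewrite E; apply: rdvdXn_le h.
Qed.

(** By the gap, an element that is not null has order below [A]; a product of two such has order at
    most [2 A - 2]. *)
Lemma null_prime p p' e e' : dle e p -> dle e' p' -> (e + e' <= d)%N ->
  null (ev w (p * p')) -> null (ev w p) \/ null (ev w p').
Proof.
move=> dp dp' ed h; apply: boolp.contrapT => /boolp.not_orP[n1 n2].
have low e1 (p1 : {mpoly k[s]}) : dle e1 p1 -> (e1 <= d)%N -> ~ null (ev w p1) ->
    ~ rdvd 'X^A (ev w p1).
  by move=> d1 le n1' h1; apply: n1'; apply: gap_forms h1 => //; apply: dle_le d1.
have := rdvdXnM_neg A0 A0 (low _ _ dp _ n1) (low _ _ dp' _ n2).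
rewrite addnn -mul2n => H; case: H; try lia.
by apply: null_low; rewrite -rmorphM.
Qed.

Lemma null_prime_factor p e : (2 * e <= d)%N -> p != 0 -> dle e p -> null (ev w p) ->
  exists q, [/\ rprime q, dle e q & null (ev w q)].
Proof.
move=> ed p0 dp nullp; have [u [v [ps [uv hps E]]]] := ufd_mpoly p0.
have : null (ev w (\prod_(q <- ps) q)).
  have := rdvd_mull (ev w v) nullp; rewrite E rmorphM mulrA -rmorphM [v * u]mulrC uv.
  by rewrite rmorph1 mul1r.
have : dle e (\prod_(q <- ps) q).
  by apply: (dle_dvd p0) => //; exists u.
have : \prod_(q <- ps) q != 0.
  by apply: contraNneq p0 => E0; rewrite E E0 mulr0.
elim: ps hps {E} => [|q ps IH] hps.
  rewrite big_nil rmorph1 => _ _ /rdvdXnP/(_ 0%N); rewrite coef1 => h.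
  by have /eqP : (1 : k) = 0 by [apply: h; lia]; rewrite oner_eq0.
rewrite big_cons => qps0 dqps; move: (qps0); rewrite mulf_eq0 negb_or => /andP[q0 ps0].
have dq : dle e q by apply: (dle_dvd qps0) dqps; exists (\prod_(q <- ps) q); rewrite mulrC.
have dps : dle e (\prod_(q <- ps) q) by apply: (dle_dvd qps0) dqps; exists q.
case/(null_prime dq dps); first by rewrite addnn -mul2n.
  by exists q; split=> //; apply: hps; rewrite mem_head.
by apply: IH => // r hr; apply: hps; rewrite inE hr orbT.
Qed.

End Forms.

(** Algebraic independence of [s] linear forms, truncated both in degree and in order. *)
Definition indep e s := exists2 w : 'I_s -> {poly k}, forall i, lin z (w i) &
  forall p : {mpoly k[s]}, p != 0 -> dle e p -> ~ null (ev w p).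

Lemma indep0 e : indep e 0.
Proof.
exists (fun=> 0) => [[]//|p p0 _]; rewrite [p]nvar0_mpolyC mmapC => /rdvdXnP/(_ 0%N).
rewrite coefC /= => h; case/negP: p0; rewrite [p]nvar0_mpolyC h ?mpolyC0 //; lia.
Qed.

(** Any [N + 1] combinations of the [N] series [z j] already satisfy a linear relation. *)
Lemma not_indep e : (0 < e)%N -> ~ indep e N.+1.
Proof.
move=> e0 [w /boolp.choice[c hc]] h.
have [u u0 uC] := wide_kernel (\matrix_(i < N.+1, j < N) c i j) (ltnSn N).
apply: (h (\sum_i u 0 i *: 'X_i)).
- apply: contraNneq u0 => E; apply/eqP/rowP => i; rewrite [RHS]mxE.
  have := congr1 (mcoeff U_(i)%MM) E; rewrite mcoeff0 raddf_sum /= (bigD1 i) //=.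
  rewrite mcoeffZ mcoeffXU eqxx mulr1 big1 ?addr0 // => j ji.
  by rewrite mcoeffZ mcoeffXU (negPf ji) mulr0.
- by apply: dle_sum => i _; apply/dleZ/dleX.
rewrite (_ : ev w _ = 0); first exact: rdvd0.
rewrite raddf_sum /= (eq_bigr (fun i => \sum_j (u 0 i * c i j) *: z j)) => [|i _].
  rewrite exchange_big big1 // => j _; rewrite -scaler_suml.
  have := congr1 (fun m : 'rV_N => m 0 j) uC; rewrite !mxE => E.
  rewrite (eq_bigr (fun i => u 0 i * (\matrix_(i < N.+1, j < N) c i j) i j)).
    by rewrite E scale0r.
  by move=> i _; rewrite mxE.
rewrite mmapZ mmapX mmap1U hc mul_polyC scaler_sumr; apply: eq_bigr => j _.
by rewrite scalerA.
Qed.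

(** Along the pairs with [s + i = N + 1], independence holds at [s = 0] and fails at [s = N + 1]. At
    the first failure the independent forms enjoy the next higher degree bound. *)
Lemma transcendence_level (lev : nat -> nat) : (0 < lev 0)%N ->
  exists s i, [/\ (s + i = N)%N, indep (lev i.+1) s & ~ indep (lev i) s.+1].
Proof.
move=> l0; apply: boolp.contrapT => no; apply: (not_indep l0).
suff H s i : (s + i = N.+1)%N -> indep (lev i) s by apply: H; rewrite addn0.
elim: s i => [|s IH] i si; first exact: indep0.
apply: boolp.contrapT => ni; apply: no; exists s, i; split=> //.
  by move: si; rewrite addSn => -[].
by apply: IH; rewrite addnS -addSn.
Qed.

Section Relation.
Variables (s e E : nat) (w : 'I_s -> {poly k}).
Hypothesis linw : forall i, lin z (w i).
Hypothesis freew : forall p : {mpoly k[s]}, p != 0 -> dle (2 * E ^ 2) p -> ~ null (ev w p).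
Hypothesis depw : ~ indep e s.+1.
Hypotheses (e0 : (0 < e)%N) (eE : (2 * e <= E)%N) (Ed : (2 * E ^ 2 <= d)%N).

Let eF : (e <= 2 * E ^ 2)%N. Proof. by rewrite -mulnn; nia. Qed.
Let e2d : (2 * e <= d)%N. Proof. by apply: leq_trans Ed; rewrite -mulnn; nia. Qed.

(** The size condition says that [q] really involves the last variable. *)
Definition relation t (q : {mpoly k[s.+1]}) :=
  [/\ rprime q, dle e q, null (ev (ext w t) q) & (1 < size (muni q))%N].

(** Dependence of [(w, t)] gives a null polynomial, and one of its prime factors is null. That
    factor involves the last variable because [w] satisfies no relation of such degree. *)
Lemma exists_relation t : lin z t -> exists q, relation t q.
Proof.
move=> lt; have lwt := lin_ext linw lt.
have [p [p0 dp np]] : exists p, [/\ p != 0, dle e p & null (ev (ext w t) p)].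
  apply: boolp.contrapT => no; apply: depw; exists (ext w t) => // p p0 dp np.
  by apply: no; exists p.
have [q [qP dq nq]] := null_prime_factor lwt e2d p0 dp np.
exists q; split=> //; rewrite ltnNge; apply/negP => sq.
have Eq : q = mwiden (muni q)`_0 by rewrite -muninC -(size1_polyC sq) muniK.
apply: (@freew (muni q)`_0).
- by have [q0 _ _] := qP; apply: contraNneq q0 => r0; rewrite Eq r0 mwiden0.
- by apply: dle_le (dle_muni_coef 0 dq).
- by move: nq; rewrite {1}Eq ev_mwiden.
Qed.

(** Otherwise eliminating the last variable between [q] and [p] gives a nonzero null polynomial in
    [w] alone, of degree at most [2 E^2]. *)
Lemma relation_dvd t q p : lin z t -> relation t q -> dle E p ->
  null (ev (ext w t) p) -> rdvd q p.
Proof.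
move=> lt [qP dq nq sq] dp np; apply: boolp.contrapT => ndvd.
have [|r [r0 dr [a [b Er]]]] := prime_elimination qP sq (dle_le _ dq) dp ndvd.
  exact: leq_trans (leq_pmull _ _) eE.
apply: (freew r0 dr); rewrite -(ev_mwiden w t) Er rmorphD !rmorphM.
by apply: rdvdD; apply: rdvd_mull.
Qed.

Lemma maximal_relation : exists t q, [/\ lin z t, relation t q &
  forall t' q', lin z t' -> relation t' q' -> (size (muni q') <= size (muni q))%N].
Proof.
pose P n := boolp.asbool (exists t q, [/\ lin z t, relation t q & size (muni q) = n]).
have lin0 : lin z 0.
  by exists (fun=> 0); rewrite big1 // => i _; rewrite scale0r.
have exP : exists n, P n.
  have [q rq] := exists_relation lin0; exists (size (muni q)); apply/boolp.asboolP.
  by exists 0, q.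
have ubP n : P n -> (n <= e.+1)%N.
  by move=> /boolp.asboolP[t [q [_ [_ dq _ _] <-]]]; apply: size_muni.
case: (ex_maxnP exP ubP) => n /boolp.asboolP[t [q [lt rq <-]]] nmax.
exists t, q; split; [exact: lt|exact: rq|move=> t' q' lt' rq'].
apply: nmax.
by apply/boolp.asboolP; exists t', q'.
Qed.

(** A family of relations of [t + x *: z j], expanded to first order in [x], gives
    [p0' * z j + p1 = 0] along [(w, t)], so [h = p0'] and [r = - p1]. Maximality of [q] bounds the
    degree of [p0] in the last variable by that of [q], hence [q] cannot divide [p0']. *)
Lemma relation_shape t q j : lin z t -> relation t q ->
  (forall t' q', lin z t' -> relation t' q' -> (size (muni q') <= size (muni q))%N) ->
  exists h r : {mpoly k[s.+1]}, [/\ dle (2 * e) h, dle (2 * e) r, ~ rdvd q h &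
    null (ev (ext w t) h * z j - ev (ext w t) r)].
Proof.
move=> lt rq qmax; have [qP dq nq sq] := rq.
have [D [DE sD sqD qmaxD]] : exists D, [/\ size (muni q) = D, (D <= e.+1)%N, (1 < D)%N &
    forall t' q', lin z t' -> relation t' q' -> (size (muni q') <= D)%N].
  by exists (size (muni q)); split; [exact: erefl|exact: size_muni|exact: sq|exact: qmax].
move: qmaxD sqD => {}qmax {}sq.
pose J := ('X_{1..s < e.+1} * 'I_D)%type.
have [|a0 [a1 [[j0 a0j] n0 n1]]] := perturbed_relation ch0
    (mon := fun j : J => ev w 'X_[j.1]) (ex := fun j => nat_of_ord j.2)
    (B := (2 * A)%N) (t := t) (zeta := z j).
  (* By maximality the relations for all [x] lie in one finite-dimensional space, with monomials
     indexed by [J]. *)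
  move=> x; have lx : lin z (t + x *: z j) by apply/linD/linZ/lin_var.
  have [q' rq'] := exists_relation lx; have [_ dq' nq' sq'] := rq'.
  have sqq := qmax _ _ lx rq'.
  exists (fun j : J => ((muni q')`_(j.2))@_(j.1)); split; last first.
    rewrite -(ev2_expand w _ sqq) -?ev_muni //.
    by move=> l; apply: dle_muni_coef.
  apply: boolp.contrapT => no; suff Eq0 : muni q' = 0 by rewrite Eq0 size_poly0 in sq'.
  apply/polyP => l; rewrite coef0; apply/mpolyP => m; rewrite mcoeff0.
  have [lD|lD] := ltnP l D; last by rewrite nth_default ?mcoeff0 // (leq_trans sqq).
  have [mE|mE] := ltnP (mdeg m) e.+1; last first.
    apply: memN_msupp_eq0; apply: msize_mdeg_ge; apply: leq_trans mE.
    exact: dle_muni_coef.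
  apply/eqP; apply: boolp.contrapT => /negP ne; apply: no.
  by exists (BMultinom mE, Ordinal lD).
have [p0 [s0 d0 c0]] := poly_of_coefs a0.
have [p1 [s1 d1 c1]] := poly_of_coefs a1.
have p0N0 : p0 != 0.
  by apply: contraNneq a0j => Ep; rewrite -c0 Ep coef0 mcoeff0.
have E0 : ev2 w t p0 = \sum_(j : J) a0 j *: (ev w 'X_[j.1] * t ^+ j.2).
  by rewrite (ev2_expand w t s0 d0); apply: eq_bigr => i _; rewrite c0.
(* Being a nonzero multiple of [q], [p0] involves the last variable, so its derivative is nonzero in
   characteristic 0. *)
have qp0 : rdvd (muni q) p0.
  rewrite -[p0]muninK; apply/rdvd_muni; apply: (relation_dvd lt rq).
    apply: (@dle_le _ _ (e + e)); first by rewrite addnn -mul2n.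
    by apply: dle_munin d0; apply: leq_trans s0 sD.
  by rewrite /null ev_munin E0.
have p0' : p0^`() != 0.
  apply: deriv_neq0; last by apply: leq_trans sq _; rewrite -DE; apply: rdvd_size qp0.
  by move=> n; rewrite -mpolyC_nat mpolyC_eq0; apply: natr_neq0.
exists (munin p0^`()), (- munin p1); split.
- rewrite mul2n -addnn; apply: dle_munin.
    by apply: leq_trans (leq_trans (ltnW (lt_size_deriv p0N0)) s0) sD.
  by move=> l; rewrite coef_deriv; apply: dleMn.
- by rewrite mul2n -addnn; apply/dleN/dle_munin => //; apply: leq_trans s1 sD.
- move/rdvd_muni; rewrite muninK => /(rdvd_size p0'); rewrite DE leqNgt => /negP; apply.
  by apply: leq_trans (lt_size_deriv p0N0) s0.
- have Eh : ev (ext w t) (munin p0^`()) =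
      \sum_(j : J) a0 j *: (ev w 'X_[j.1] * (t ^+ (j.2).-1 *+ j.2)).
    apply: (etrans (ev_munin w t _)); apply: (etrans (ev2_deriv_expand w t s0 d0)).
    by apply: eq_bigr => i _; rewrite c0.
  have Er : ev (ext w t) (munin p1) = \sum_(j : J) a1 j *: (ev w 'X_[j.1] * t ^+ j.2).
    apply: (etrans (ev_munin w t _)); apply: (etrans (ev2_expand w t s1 d1)).
    by apply: eq_bigr => i _; rewrite c1.
  have EN : ev (ext w t) (- munin p1) = - ev (ext w t) (munin p1) by exact: mmapN.
  by rewrite EN opprK Er Eh mulr_suml.
Qed.

End Relation.
End Jet.
End Core.

Module CoreTheorem. Import mpoly MPolyFacts Consistency JetLift GenericPoint Core Gap.

Lemma dle_bordered (k : fieldType) v a b (M : 'M[{mpoly k[v]}]_(a, b)) (c : 'cV_a) e r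
    (I : 'I_r -> 'I_a) (J : 'I_r -> 'I_b) i0 :
  (forall i j, dle e (M i j)) -> (forall i, dle e (c i 0)) ->
  dle ((r + 2) * e) (bordered M I J i0 c).
Proof.
move=> dM dc; apply: dleB.
  apply: (@dle_le _ _ (r * e + e)); first by rewrite mulnDl; lia.
  by apply: dleM => //; apply: dle_det => i j; rewrite mxE.
rewrite mxE; apply: dle_sum => i _; rewrite !mxE.
apply: (@dle_le _ _ (e + r.-1 * e + e)).
  by rewrite addnAC addnn -mul2n -mulnDl leq_mul2r addnC leq_add2r leq_pred orbT.
apply: dleM => //; apply: dle_sum => j _; rewrite !mxE; apply: dleM => //.
by apply: dle_sign; apply: dle_det => i' j'; rewrite !mxE.
Qed.

(* The relation tying the last form has degree at most [e]; then [h] and [rho] have degree at most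
   [N * (2 * e)], the entries of the linear system at most [(D + 2)] times that, and its bordered
   minors at most [minor_deg].  Eliminating the last form from a polynomial of that degree gives
   one of degree at most [next_level]. *)
Definition minor_deg N D e := ((N + 3) * ((D + 2) * (N * (2 * e))))%N.

Definition next_level N D e := (2 * minor_deg N D e ^ 2)%N.

Definition level N D i := iter i (next_level N D) 1%N.

(** The order that [order_gap] requires for a gap in the degree of the top level. *)
Definition jet_order N D := (2 * (2 * gapE N (level N D N.+1)) ^ N)%N.

Lemma minor_deg_ge N D e : (0 < N)%N -> (2 * e <= minor_deg N D e)%N.
Proof. by move=> N0; rewrite /minor_deg; nia. Qed.

Lemma level_gt0 N D i : (0 < N)%N -> (0 < level N D i)%N.
Proof.
move=> N0; elim: i => //= i IH; rewrite /next_level muln_gt0 expn_gt0 /= orbF.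
by apply: leq_trans (minor_deg_ge D _ N0); rewrite muln_gt0.
Qed.

Lemma level_mono N D i j : (0 < N)%N -> (i <= j)%N -> (level N D i <= level N D j)%N.
Proof.
move=> N0; elim: j => [|j IH]; first by rewrite leqn0 => /eqP->.
rewrite leq_eqVlt => /orP[/eqP->//|]; rewrite ltnS => /IH le; apply: leq_trans le _.
rewrite /level /= /next_level -/(level N D j).
have := minor_deg_ge D (level N D j) N0; have := level_gt0 D j N0.
rewrite -mulnn; nia.
Qed.

Section Core.
Variables (k : fieldType) (N n m : nat) (sigma : 'I_n -> 'I_N).
Variables (F : 'I_n -> {mpoly k[N]}) (G : 'I_m -> {mpoly k[N]}) (D : nat).
Hypothesis ch0 : [pchar k] =i pred0.
Hypothesis sigma_inj : injective sigma.
Hypothesis N0 : (0 < N)%N.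
Hypothesis dF : forall i, dle D (F i).
Hypothesis dG : forall j, dle D (G j).
Variable z : 'I_N -> {poly k}.
Hypothesis jetF : forall i, rdvd 'X^(jet_order N D) ((z (sigma i))^`() - mmap polyC z (F i)).
Hypothesis jetG : forall j, rdvd 'X^(jet_order N D) (mmap polyC z (G j)).

Theorem jet_consistent : consistent sigma F G.
Proof.
have [A [A0 AK gap]] := order_gap z (level_gt0 D N.+1 N0) (leqnn (jet_order N D)).
have [s [i [si [w linw freew] depw]]] := transcendence_level z A0 (lev := level N D) isT.
set e := level N D i in depw; set E := minor_deg N D e.
have e0 : (0 < e)%N := level_gt0 D i N0.
have eE : (2 * e <= E)%N := minor_deg_ge D e N0.
(* By definition [2 * E ^ 2] is the level following [e], the one in which [w] is independent. *)
have Ed : (2 * E ^ 2 <= level N D N.+1)%N.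
  by apply: (@level_mono N D i.+1) => //; rewrite ltnS -si leq_addl.
have Ed' : (E <= level N D N.+1)%N.
  by apply: leq_trans Ed; rewrite -mulnn; nia.
have {}freew : forall p : {mpoly k[s]}, p != 0 -> dle (2 * E ^ 2) p ->
  ~ null A (mmap polyC w p) := freew.
have [t [q [lt rq qmax]]] := maximal_relation A0 gap linw freew depw e0 eE Ed.
have rdv := relation_dvd freew eE lt rq.
have /boolp.choice[h_ /boolp.choice[r_ hr]] :=
  fun j => relation_shape ch0 A0 gap linw freew depw e0 eE Ed j lt rq qmax.
have [qP dq nq sq] := rq.
pose ev : {rmorphism {mpoly k[s.+1]} -> {poly k}} := mmap polyC (ext w t).
(* The fractions [r_ j / h_ j] are put over the common denominator [h], with [rho j] as
   numerators. *)
pose h := \prod_i h_ i.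
pose rho j := \prod_i (if i == j then r_ j else h_ i).
pose e1 := (N * (2 * e))%N.
have e1E : ((D + 2) * e1 = D * e1 + (e1 + e1))%N by rewrite mulnDl mul2n -addnn.
have dh : dle e1 h.
  rewrite /e1 -[N in (N * _)%N]card_ord -sum_nat_const.
  by apply: (@dle_prod _ _ _ _ (fun=> 2 * e)%N) => j; have [] := hr j.
have drho j : dle e1 (rho j).
  rewrite /e1 -[N in (N * _)%N]card_ord -sum_nat_const.
  apply: (@dle_prod _ _ _ _ (fun=> 2 * e)%N) => l.
  by case: eqP => _; [have [] := hr j|have [] := hr l].
have qh : ~ rdvd q h.
  by move/(rdvd_prime_prod qP) => [j _]; have [] := hr j.
have evz j : rdvd 'X^(2 * A) (ev h * z j - ev (rho j)).
  have -> : ev h * z j - ev (rho j) =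
      (\prod_(i | i != j) ev (h_ i)) * (ev (h_ j) * z j - ev (r_ j)).
    rewrite /h /rho !rmorph_prod (bigD1 j) //= [X in _ - X](bigD1 j) //= eqxx.
    rewrite [\prod_(i | i != j) ev (if _ then _ else _)](eq_bigr (fun i => ev (h_ i))).
      by ring.
    by move=> l /negPf->.
  by apply: rdvd_mull; have [] := hr j.
(* The linear system has [n + 1] rows, so its minors satisfy [r + 2 <= N + 3], the first factor of
   [minor_deg]. *)
have nN : (n <= N)%N by rewrite -[n]card_ord -[N]card_ord; apply: leq_card sigma_inj.
pose c : {rmorphism k -> {mpoly k[s.+1]}} := @mpolyC s.+1 k.
pose y l := (ext w t l)^`().
have dhom p : dle D p -> dle (D * e1) (hom_eval D c rho h p).
  by move=> dp; apply: dle_hom_eval.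
apply: (jet_vector_field (pd := fun l => mderiv l) (c := c) (q := q) (h := h) (rho := rho)
  (ev := ev) (y := y) (A := A) (K := jet_order N D) (z := z) _ _ _ _ qP qh AK dF dG nq evz
  jetF jetG).
- by move=> l; split=> p p'; rewrite ?mderivD ?mderivM.
- by move=> l x; apply: mderivC.
- by move=> x; apply: mmapC.
- by move=> p; apply: ev_deriv.
- move=> j; apply: rdv; apply: dle_le (dhom _ (dG j)).
  by apply: (@leq_trans ((D + 2) * e1)); rewrite ?leq_pmull ?addn3 // e1E leq_addr.
- move=> r I J i0 rn small.
  have db : dle E (bordered (vf_matrix sigma D (fun l => mderiv l) q h rho) I J i0
      (vf_rhs F D c h rho)).
    apply: (@dle_le _ _ ((r + 2) * ((D + 2) * e1))).
      by rewrite leq_mul2r; apply/orP; right; move: rn nN; lia.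
    apply: dle_bordered => [i1 l|i1]; rewrite mxE; case: unlift => [i'|].
    - rewrite e1E; apply: dleM; first exact: dleXn.
      by apply: dleB; apply: dleM => //; apply: dle_deriv.
    - apply: dle_deriv; apply: dle_le dq; rewrite /e1 /e; move: e0 N0; nia.
    - rewrite e1E addnC; apply: dleM; last exact: dhom.
      by rewrite addnn -mul2n; apply: dleXn.
    - exact: dle0.
  (* The gap restores the order lost by differentiation, as [A <= 2 A - 1]. *)
  apply: rdv => //; apply: (gap_forms gap (lin_ext linw lt) (j := (2 * A).-1)) => //.
    exact: dle_le db.
  by move: A0; lia.
Qed.

End Core.
End CoreTheorem.

(** * Differential polynomials and jets *)

Module MalgFacts.

Section MonomialEvaluation.
Variables (I : choiceType) (S : comNzRingType) (v : I -> S).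

Definition mon_eval (k : {cmonom I}) : S := \prod_(i <- finsupp k) v i ^+ k i.

Lemma mon_evalEw (d : {fset I}) (k : {cmonom I}) : (finsupp k `<=` d)%fset ->
  mon_eval k = \prod_(i <- d) v i ^+ k i.
Proof.
move=> le; rewrite /mon_eval [LHS](big_fset_incl _ le) => //= i _.
by rewrite -cmE_eq0 => /eqP->; rewrite expr0.
Qed.

Lemma mon_eval_mmorphism : mmorphism mon_eval.
Proof.
split=> [k1 k2|]; last by rewrite /mon_eval mdom1 big_seq_fset0.
have s1 : (finsupp k1 `<=` finsupp (mmul k1 k2))%fset by rewrite mdomD fsubsetUl.
have s2 : (finsupp k2 `<=` finsupp (mmul k1 k2))%fset by rewrite mdomD fsubsetUr.
rewrite (mon_evalEw s1) (mon_evalEw s2) /mon_eval -big_split.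
by apply: eq_bigr => i _; rewrite cmM exprD.
Qed.

HB.instance Definition _ := isMultiplicative.Build _ S mon_eval mon_eval_mmorphism.

Lemma mon_eval_var i : mon_eval (ucm i) = v i.
Proof.
have s : (finsupp (ucm i) `<=` [fset i])%fset by rewrite mdomU fsubset_refl.
by rewrite (mon_evalEw s) big_seq_fset1 cmUU.
Qed.

End MonomialEvaluation.

Lemma poly_in_eval (I : choiceType) (S : comNzRingType) (c : {rmorphism CC -> S})
    (v : I -> S) :
  exists f : {rmorphism poly_in I -> S}, (forall x, f x%:MP = c x) /\
    forall i, f (pvar i) = v i.
Proof.
pose f : {rmorphism poly_in I -> S} := mmap c (mon_eval v).
exists f; split=> [x|i]; first exact: mmapC.
by apply: (etrans (mmapU _ _)); rewrite /= rmorph1 mul1r mon_eval_var.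
Qed.

Lemma poly_in_ind (I : choiceType) (P : poly_in I -> Prop) :
  (forall c, P c%:MP) -> (forall i, P (pvar i)) ->
  (forall a b, P a -> P b -> P (a + b)) -> (forall a b, P a -> P b -> P (a * b)) ->
  forall a, P a.
Proof.
move=> PC PX PD PM a.
have PU (k : {cmonom I}) : P << k >>.
  move: {2}(mdeg k) (leqnn (mdeg k)) => n; elim: n k => [|n IH] k.
    by rewrite leqn0 mdeg_eq0 => /eqP->; apply: PC.
  move=> kn; have [k1|k1] := eqVneq k mone; first by rewrite k1; apply: PC.
  have [i ik] : exists i, i \in finsupp k.
    have [E|[i ik]] := fset_0Vmem (finsupp k); last by exists i.
    case/negP: k1; rewrite -mdeg_eq0 mdegE E big_seq_fset0 //.
  have Ek : k = mmul (ucm i) (divcm k (ucm i)).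
    apply/eqP/cmP => j; rewrite cmM divcmE ucmE subnKC //.
    by case: eqP => // <-; rewrite lt0n cmE_neq0.
  have -> : << k >> = pvar i * << divcm k (ucm i) >> :> poly_in I.
    by rewrite {1}Ek /pvar malgM_def fgmulUU mulr1.
  apply: PM => //; apply: IH; move: kn; rewrite {1}Ek mdegM mdegU.
  by rewrite add1n ltnS.
rewrite [a]monalgE; apply: big_ind => //; first by have := PC 0; rewrite monalgU0.
move=> k _; have -> : << a@_k *g k >> = (a@_k)%:MP * << k >> :> poly_in I.
  by rewrite malgM_def fgmulUU mulr1 mul1m.
exact: PM.
Qed.

Lemma rmorph_malgZ (I : choiceType) (S : comNzRingType) (f : {rmorphism poly_in I -> S})
    (x : CC) (a : poly_in I) : f (x *: a) = f x%:MP * f a.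
Proof. by rewrite -rmorphM; congr (f _); rewrite mul_malgC. Qed.

Lemma big_finsupp (T : Type) (idx : T) (op : Monoid.com_law idx) N (d : {fset 'I_N})
    (f : 'I_N -> T) : (forall i, i \notin d -> f i = idx) ->
  \big[op/idx]_i f i = \big[op/idx]_(i <- d) f i.
Proof.
move=> h; transitivity (\big[op/idx]_(i | i \in d) f i).
  by rewrite [RHS]big_mkcond; apply: eq_bigr => i _; case: ifP => // /negbT /h.
rewrite -[LHS]big_filter; apply/perm_big/uniq_perm; [|exact: fset_uniq|].
  by rewrite filter_uniq // index_enum_uniq.
by move=> i; rewrite mem_filter mem_index_enum andbT.
Qed.

End MalgFacts.

Module Conversion. Import mpoly MPolyFacts Consistency MalgFacts.

Section Conversion.
Variables (N : nat) (K : fieldType) (c : {rmorphism CC -> K}).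

(** Passes from the monoid algebra of the statement to [mpoly], extending scalars from [CC] to [K]
    along [c]. *)
Definition conv (p : OPoly N) : {mpoly K[N]} :=
  \sum_(k <- monalg.msupp p) c (monalg.mcoeff k p) *: 'X_[[multinom k i | i < N]].

Lemma dle_conv D p : (monalg.mmeasure monalg.mdeg p <= D.+1)%N -> dle D (conv p).
Proof.
move=> sp; rewrite /conv big_seq; apply: dle_sum => k kp.
apply: dleZ; rewrite /dle msizeX ltnS.
have := leq_trans (monalg.msize_mdeg_lt kp) sp; rewrite ltnS; apply: leq_trans.
rewrite mdegE monalg.mdegE (eq_bigr (fun i => k i)) => [|i _]; last by rewrite mnmE.
by rewrite (big_finsupp _ (d := finsupp k)) // => i; rewrite -cmE_eq0 => /eqP.
Qed.

Lemma mmap_conv (S : comNzRingType) (c' : {rmorphism K -> S}) (zeta : 'I_N -> S) p :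
  mmap c' zeta (conv p) =
  \sum_(k <- monalg.msupp p) c' (c (monalg.mcoeff k p)) *
     \prod_(i <- finsupp k) zeta i ^+ k i.
Proof.
rewrite /conv rmorph_sum; apply: eq_bigr => k _ /=.
rewrite mmapZ mmapX; congr (_ * _); rewrite /mmap1.
rewrite (big_finsupp _ (d := finsupp k)) => [|i].
  by apply: eq_bigr => i _; rewrite mnmE.
by rewrite mnmE -cmE_eq0 => /eqP->; rewrite expr0.
Qed.

Lemma morph_embed0 (S : comNzRingType) (c' : {rmorphism K -> S})
    (f : {rmorphism DPoly N -> S}) p :
  (forall x, f (monalg.mkmalgU mone x) = c' (c x)) ->
  f (embed0 p) = mmap c' (fun i => f (pvar ((i, 0%N) : dvar N))) (conv p).
Proof.
move=> fc; rewrite mmap_conv /embed0 rmorph_sum; apply: eq_bigr => k _.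
refine (etrans (rmorph_malgZ f _ _) (congr2 *%R (fc _) _)).
apply: (etrans (rmorph_prod f _ _ _)); apply: eq_bigr => i _; exact: rmorphXn.
Qed.

End Conversion.
End Conversion.

Module DiffRing. Import MalgFacts Conversion Consistency.

Lemma morph_der_add (R B : comNzRingType) (f : {rmorphism R -> B}) d D a b :
  derivation d -> derivation D -> f (d a) = D (f a) -> f (d b) = D (f b) ->
  f (d (a + b)) = D (f (a + b)).
Proof. by move=> [dD _] [DD _] Ea Eb; rewrite dD !rmorphD DD Ea Eb. Qed.

Lemma morph_der_mul (R B : comNzRingType) (f : {rmorphism R -> B}) d D a b :
  derivation d -> derivation D -> f (d a) = D (f a) -> f (d b) = D (f b) ->
  f (d (a * b)) = D (f (a * b)).
Proof. by move=> [_ dM] [_ DM] Ea Eb; rewrite dM rmorphD !rmorphM DM Ea Eb. Qed.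

Section Derivation.
Variables (N : nat) (d : DPoly N -> DPoly N).
Hypothesis dP : total_derivation d.

Lemma total_derivationP : derivation d.
Proof. by have [dD dM _ _] := dP. Qed.

Lemma diff_morph (B : comNzRingType) (D : B -> B) (f : {rmorphism DPoly N -> B}) :
  derivation D -> (forall c : CC, D (f c%:MP) = 0) ->
  (forall i p, f (pvar ((i, p.+1) : dvar N)) = D (f (pvar ((i, p) : dvar N)))) ->
  forall a, f (d a) = D (f a).
Proof.
move=> DP DC DX; have [_ _ dC dX] := dP; have dP' := total_derivationP.
apply: poly_in_ind => [c|[i p]|a b Ea Eb|a b Ea Eb].
- by rewrite dC rmorph0 DC.
- exact: etrans (congr1 f (dX i p)) (DX i p).
- exact: morph_der_add.
- exact: morph_der_mul.
Qed.

(* [ord_le k a]: only derivatives of order at most [k] are needed to write [a]. *)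
Inductive ord_le : nat -> DPoly N -> Prop :=
| OrdC k (c : CC) : ord_le k c%:MP
| OrdX k i p : (p <= k)%N -> ord_le k (pvar ((i, p) : dvar N))
| OrdD k a b : ord_le k a -> ord_le k b -> ord_le k (a + b)
| OrdM k a b : ord_le k a -> ord_le k b -> ord_le k (a * b).

Lemma ord_leS k a : ord_le k a -> ord_le k.+1 a.
Proof.
elim=> [l c|l i p pl|l x y _ h1 _ h2|l x y _ h1 _ h2].
- exact: OrdC.
- by apply: OrdX; apply: leqW.
- exact: OrdD.
- exact: OrdM.
Qed.

Lemma ord_le_d k a : ord_le k a -> ord_le k.+1 (d a).
Proof.
have [dD dM dC dX] := dP.
elim=> [l c|l i p pl|l x y _ h1 _ h2|l x y ox h1 oy h2].
- by rewrite dC -(rmorph0 (@malgC _ _)); apply: OrdC.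
- by rewrite (dX i p); apply: OrdX.
- by rewrite dD; apply: OrdD.
- by rewrite dM; apply: OrdD; apply: OrdM => //; apply: ord_leS.
Qed.

Lemma ord_le_iter k a : ord_le 0 a -> ord_le k (iter k d a).
Proof. by move=> oa; elim: k => //= k IH; apply: ord_le_d. Qed.

Lemma ord_le_embed0 (p : OPoly N) : ord_le 0 (embed0 p).
Proof.
have o0 : ord_le 0 0 by rewrite -(rmorph0 (@malgC _ _)); apply: OrdC.
have o1 : ord_le 0 1 by rewrite -(rmorph1 (@malgC _ _)); apply: OrdC.
rewrite /embed0; apply: big_ind => // [x y|k _]; first exact: OrdD.
rewrite -mul_malgC; apply: OrdM; first exact: OrdC.
apply: big_ind => // [x y|i _]; first exact: OrdM.
elim: (k i) => [|e IH]; first by rewrite expr0; exact: o1.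
by rewrite exprS; apply: OrdM; [exact: OrdX|exact: IH].
Qed.

Lemma ord_le_agree (S : nzRingType) (f g : {rmorphism DPoly N -> S}) M :
  (forall c : CC, f c%:MP = g c%:MP) ->
  (forall i p, (p <= M)%N -> f (pvar ((i, p) : dvar N)) = g (pvar ((i, p) : dvar N))) ->
  forall k a, ord_le k a -> (k <= M)%N -> f a = g a.
Proof.
move=> hC hX k a; elim=> [l c|l i p pl|l x y _ h1 _ h2|l x y _ h1 _ h2] lM.
- exact: hC.
- by apply: hX; apply: leq_trans lM.
- apply: (etrans (rmorphD f x y)); rewrite h1 // h2 //; exact/esym/(rmorphD g).
- apply: (etrans (rmorphM f x y)); rewrite h1 // h2 //; exact/esym/(rmorphM g).
Qed.

End Derivation.

Lemma in_ideal_is_ideal (R : comNzRingType) (S : seq R) : is_ideal (in_ideal S).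
Proof.
split.
- exists (nseq (size S) 0); rewrite size_nseq; split=> //.
  by rewrite big1 // => i _; rewrite nth_nseq ltn_ord mul0r.
- move=> _ _ [cs [sc ->]] [cs' [sc' ->]].
  exists [seq cs`_i + cs'`_i | i <- iota 0 (size S)]; rewrite size_map size_iota; split=> //.
  rewrite -big_split; apply: eq_bigr => i _.
  by rewrite (nth_map 0%N) ?size_iota // nth_iota // mulrDl.
- move=> r _ [cs [sc ->]]; exists [seq r * x | x <- cs]; rewrite size_map; split=> //.
  rewrite mulr_sumr; apply: eq_bigr => i _.
  by rewrite (nth_map 0) ?sc // mulrA.
Qed.

Lemma mem_in_ideal (R : comNzRingType) (S : seq R) x : x \in S -> in_ideal S x.
Proof.
move=> xS; exists [seq (i == index x S)%:R | i <- iota 0 (size S)].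
rewrite size_map size_iota; split=> //.
have ix : (index x S < size S)%N by rewrite index_mem.
rewrite (bigD1 (Ordinal ix)) //= big1 => [|i ne].
  by rewrite (nth_map 0%N) ?size_iota // nth_iota // add0n eqxx mul1r nth_index // addr0.
by rewrite (nth_map 0%N) ?size_iota // nth_iota // add0n -val_eqE /= in ne *;
  rewrite (negPf ne) mul0r.
Qed.

Section Systems.
Variables (n m s : nat) (d : DPoly (n + m) -> DPoly (n + m)).
Variables (f : 'I_n -> OPoly (n + m)) (g : 'I_s -> OPoly (n + m)).
Hypothesis dP : total_derivation d.
Let N := (n + m)%N.

Lemma trunc_sub_diff L p :
  in_ideal (@trunc_gens n m s d f g L) p -> in_diff_ideal d (@sys_gens n m s f g) p.
Proof.
move=> [cs [_ ->]] I idI Id IS.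
have [I0 ID IM] := idI; have [dD dM dC dX] := dP.
have d0 : d 0 = 0 := derivation0 (total_derivationP dP).
have dB x y : d (x - y) = d x - d y by apply: (addIr (d y)); rewrite -dD !subrK.
have Iiter k x : I x -> I (iter k d x) by move=> Ix; elim: k => //= k IH; apply: Id.
have iterB k x y : iter k d (x - y) = iter k d x - iter k d y.
  by elim: k => //= k ->.
have iterX k (i : 'I_N) : iter k d (pvar ((i, 1%N) : dvar N)) = pvar ((i, k.+1) : dvar N).
  by elim: k => [|k IH]; [exact: erefl|exact: etrans (congr1 d IH) (dX _ _)].
apply: ideal_sum => // i _; apply: IM.
have : (trunc_gens d f g L)`_i \in trunc_gens d f g L by apply: mem_nth.
rewrite mem_cat => /orP[] /allpairsP[[k j] /= [_ _ ->]].
  have Ij : I (pvar ((lshift m j, 1%N) : dvar N) - embed0 (f j)).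
    apply: IS; rewrite mem_cat; apply/orP; left.
    by apply/mapP; exists j; rewrite ?mem_enum.
  by have := Iiter k _ Ij; rewrite iterB iterX.
apply/Iiter/IS; rewrite mem_cat; apply/orP; right.
by apply/mapP; exists j; rewrite ?mem_enum.
Qed.

(** Sending the [p]-th derivative of variable [i] to [D^p (zeta i)] commutes with the derivations.
    The preimage of [J] is a proper differential ideal containing the system. *)
Lemma consistent_not_diff (K : fieldType) (c : {rmorphism CC -> K}) :
  consistent (@lshift n m) (fun i => conv c (f i)) (fun j => conv c (g j)) ->
  ~ in_diff_ideal d (@sys_gens n m s f g) 1.
Proof.
move=> [B [D [J [c' [zeta [DP Dc [idJ J1 JD] hF hG]]]]]] h1.
have [psi [psiC psiX]] := poly_in_eval (c' \o c) (fun v : dvar N => iter v.2 D (zeta v.1)).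
have psid : forall a, psi (d a) = D (psi a).
  apply: (diff_morph dP DP) => [x|i p].
    exact: etrans (congr1 D (psiC x)) (Dc _).
  have E : psi (pvar ((i, p) : dvar N)) = iter p D (zeta i) := psiX (i, p).
  have E' : psi (pvar ((i, p.+1) : dvar N)) = D (iter p D (zeta i)) := psiX (i, p.+1).
  exact: etrans E' (congr1 D (esym E)).
have psi0 p : psi (embed0 p) = mpoly.mmap c' zeta (conv c p).
  apply: (etrans (morph_embed0 (c := c) (c' := c') p psiC)).
  congr (mpoly.mmap c' _ _).
  by apply/boolp.funext => i; exact: psiX.
have [J0 JDD JM] := idJ.
apply: J1; rewrite -(rmorph1 psi).
apply: (h1 (fun a => J (psi a))).
- split; first by rewrite rmorph0.
    by move=> x y Jx Jy; rewrite rmorphD; apply: JDD.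
  by move=> r x Jx; rewrite rmorphM; apply: JM.
- by move=> x Jx; rewrite psid; apply: JD.
- move=> a; rewrite mem_cat => /orP[] /mapP[j _ ->].
    rewrite rmorphB; move: (hF j); congr (J (_ - _)); last exact/esym/psi0.
    exact/esym/psiX.
  by rewrite psi0; apply: hG.
Qed.

(** The jet is the Taylor polynomial whose derivatives at 0 are the values of [phi]. The derivatives
    at 0 of an equation along it are then the values of [phi] at the total derivatives of that
    equation. *)
Lemma jets_of_point (K : fieldType) (c : {rmorphism CC -> K})
    (phi : {rmorphism DPoly N -> K}) L :
  [pchar K] =i pred0 -> (forall x : CC, phi x%:MP = c x) ->
  (forall a, a \in trunc_gens d f g L -> phi a = 0) ->
  exists z : 'I_N -> {poly K},
    (forall i, rdvd 'X^(L.+1) ((z (lshift m i))^`() - mpoly.mmap polyC z (conv c (f i)))) /\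
    (forall j, rdvd 'X^(L.+1) (mpoly.mmap polyC z (conv c (g j)))).
Proof.
move=> ch0 phiC phi0.
have fact0 p : p`!%:R != 0 :> K.
  by rewrite (pcharf0P K).1 // -lt0n fact_gt0.
(* Derivatives up to order [L + 1] are needed, because the equation for the derivative of [z] is
   required modulo ['X^(L.+1)]. *)
pose z (i : 'I_N) := \poly_(p < L.+2) (phi (pvar ((i, p) : dvar N)) / p`!%:R).
have zder i p : (p <= L.+1)%N -> (z i)^`(p).[0] = phi (pvar ((i, p) : dvar N)).
  move=> pL; rewrite horner_coef0 coef_derivn addn0 coef_poly ltnS pL.
  by rewrite ffactnn -[LHS]mulr_natr divfK.
have vanish (a : {poly K}) : (forall k, (k <= L)%N -> a^`(k).[0] = 0) -> rdvd 'X^(L.+1) a.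
  move=> h; apply/rdvdXnP => k kL; have := h k kL.
  rewrite horner_coef0 coef_derivn addn0 ffactnn -mulr_natr => /eqP.
  by rewrite mulf_eq0 (negPf (fact0 k)) orbF => /eqP.
have [psi [psiC psiX]] := poly_in_eval (polyC \o c) (fun v : dvar N => (z v.1)^`(v.2)).
have derP : derivation (@deriv K) by split=> x y; rewrite ?derivD ?derivM.
have psid : forall a, psi (d a) = (psi a)^`().
  apply: (diff_morph dP derP) => [x|i p].
    exact: etrans (congr1 (@deriv K) (psiC x)) (derivC _).
  have E : psi (pvar ((i, p) : dvar N)) = (z i)^`(p) := psiX (i, p).
  have E' : psi (pvar ((i, p.+1) : dvar N)) = ((z i)^`(p))^`() := psiX (i, p.+1).
  exact: etrans E' (congr1 (@deriv K) (esym E)).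
have psi_iter k a : psi (iter k d a) = (psi a)^`(k).
  elim: k => [|k IH]; first exact: erefl.
  exact: etrans (psid _) (congr1 (@deriv K) IH).
have psi0 p : psi (embed0 p) = mpoly.mmap polyC z (conv c p).
  apply: (etrans (morph_embed0 (c := c) (c' := polyC) p psiC)).
  congr (mpoly.mmap polyC _ _).
  by apply/boolp.funext => i; exact: psiX.
(* The morphisms [f0] and [phi] agree on derivatives of order at most [L + 1], hence on every
   polynomial of order at most [L + 1]. *)
pose f0 : {rmorphism DPoly N -> K} := horner_eval 0 \o psi.
have agree k p : (k <= L.+1)%N ->
    (mpoly.mmap polyC z (conv c p))^`(k).[0] = phi (iter k d (embed0 p)).
  move=> kL; rewrite -psi0 -psi_iter.
  apply: (ord_le_agree (f := f0) (g := phi) (M := L.+1)) kL.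
  - move=> x; rewrite phiC; apply: (etrans (congr1 (horner_eval 0) (psiC x))).
    by rewrite /horner_eval hornerC.
  - move=> i q qL; apply: (etrans (congr1 (horner_eval 0) (psiX (i, q)))).
    exact: zder.
  - exact/ord_le_iter/ord_le_embed0.
exists z; split=> [i|j]; apply: vanish => k kL.
  rewrite derivnB hornerD hornerN -derivSn zder // agree //; last exact: leqW.
  rewrite -rmorphB; apply: phi0; rewrite mem_cat; apply/orP; left.
  by apply/allpairsP; exists (k, i); rewrite mem_iota mem_enum.
rewrite agree; last exact: leqW.
apply: phi0; rewrite mem_cat; apply/orP; right.
by apply/allpairsP; exists (k, j); rewrite mem_iota mem_enum.
Qed.

(** If 1 is outside the truncated ideal, a residue field provides a point, its Taylor expansion a
    jet, and [H] a differential ring excluding 1 from the differential ideal. The residue field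
    contains [CC], so it has characteristic 0. *)
Theorem jets_decide L :
  (forall (K : fieldType) (c : {rmorphism CC -> K}) (z : 'I_N -> {poly K}),
     [pchar K] =i pred0 ->
     (forall i, rdvd 'X^(L.+1) ((z (lshift m i))^`() - mpoly.mmap polyC z (conv c (f i)))) ->
     (forall j, rdvd 'X^(L.+1) (mpoly.mmap polyC z (conv c (g j)))) ->
     consistent (@lshift n m) (fun i => conv c (f i)) (fun j => conv c (g j))) ->
  in_diff_ideal d (@sys_gens n m s f g) 1 <-> in_ideal (@trunc_gens n m s d f g L) 1.
Proof.
move=> H; split; last exact: trunc_sub_diff.
move=> h1; apply: boolp.contrapT => h2.
have [K [phi phi0]] := Krull.residue_field (in_ideal_is_ideal _) h2.
pose c : {rmorphism CC -> K} := phi \o (@malgC _ _).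
have ch0 : [pchar K] =i pred0.
  by move=> p; rewrite (fmorph_pchar c) Num.Theory.pchar_num.
have [z [hF hG]] := jets_of_point (c := c) ch0 (fun x => erefl)
  (fun a ha => phi0 a (mem_in_ideal ha)).
exact: consistent_not_diff (H K c z ch0 hF hG) h1.
Qed.

End Systems.
End DiffRing.

(** * Degenerate parameters *)

Module EdgeCases. Import mpoly MPolyFacts Consistency CoreTheorem.

Section Edge.
Variables (k : fieldType) (N n s : nat) (sigma : 'I_n -> 'I_N).
Variables (F : 'I_n -> {mpoly k[N]}) (G : 'I_s -> {mpoly k[N]}).

Lemma zero_is_ideal (R : comNzRingType) : is_ideal (fun x : R => x = 0).
Proof.
by split=> [//|x y -> ->|r x ->]; rewrite ?addr0 ?mulr0.
Qed.

(** The variables themselves are a solution for the vector field [\sum_i F i * d/dX_(sigma i)] on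
    the polynomial ring. *)
Lemma unconstrained_consistent : injective sigma -> (forall j, G j = 0) ->
  consistent sigma F G.
Proof.
move=> sinj G0; pose D p := \sum_i F i * mderiv (sigma i) p.
have mderivP (l : 'I_N) : derivation (fun p : {mpoly k[N]} => mderiv l p).
  by split=> x y; rewrite ?mderivD ?mderivM.
have DP : derivation D := JetLift.sum_derivation F (fun i => mderivP (sigma i)).
exists {mpoly k[N]}, D, (fun x => x = 0), (@mpolyC N k), (fun i => 'X_i); split.
- exact: DP.
- by move=> x; rewrite /D big1 // => i _; rewrite mderivC mulr0.
- split; [exact: zero_is_ideal|by move/eqP; rewrite oner_eq0|].
  by move=> x ->; apply: derivation0 DP.
- move=> i; apply/eqP; rewrite subr_eq0; apply/eqP.
  have -> : mmap (@mpolyC N k) (fun i => 'X_i) (F i) = F i.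
    apply: (mpoly_morph_eq (f := mmap (@mpolyC N k) (fun i => 'X_i)) (g := idfun)) => [x|j] /=.
      by rewrite mmapC.
    by rewrite mmapX mmap1U.
  rewrite /D (bigD1 i) //= mderivX mnm1E eqxx scale1r big1 => [|j ji].
    rewrite (_ : (_ - _)%MM = 0%MM) ?mpolyX0 ?mulr1 ?addr0 //.
    by apply/mnmP => l; rewrite mnmBE mnm0E subnn.
  rewrite mderivX mnm1E (_ : sigma i == sigma j = false) ?scale0r ?mulr0 //.
  by rewrite (inj_eq sinj) eq_sym (negPf ji).
- by move=> j; rewrite G0 mmap0.
Qed.

Lemma stationary_consistent (x : 'I_N -> k) :
  (forall i, mmap idfun x (F i) = 0) -> (forall j, mmap idfun x (G j) = 0) ->
  consistent sigma F G.
Proof.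
move=> F0 G0; exists k, (fun=> 0), (fun x => x = 0), idfun, x; split=> //.
- by split=> a b; rewrite ?mul0r ?mulr0 addr0.
- split=> //; [exact: zero_is_ideal|by move/eqP; rewrite oner_eq0].
- by move=> i; rewrite F0 subr0.
Qed.

Lemma mmap_coef0 (z : 'I_N -> {poly k}) p :
  (mmap polyC z p)`_0 = mmap idfun (fun i => (z i)`_0) p.
Proof.
pose f : {rmorphism {mpoly k[N]} -> k} := horner_eval 0 \o mmap polyC z.
rewrite -horner_coef0.
apply: (mpoly_morph_eq (f := f) (g := mmap idfun (fun i => (z i)`_0))) => [x|i] /=.
  by rewrite /horner_eval !mmapC hornerC.
by rewrite /horner_eval !mmapX !mmap1U horner_coef0.
Qed.

Lemma constant_consistent (z : 'I_N -> {poly k}) : injective sigma ->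
  (forall j, dle 0 (G j)) -> (forall j, rdvd 'X^1 (mmap polyC z (G j))) ->
  consistent sigma F G.
Proof.
move=> sinj dG jetG; apply: unconstrained_consistent => // j.
have E : G j = ((G j)@_0%MM)%:MP by apply: msize1_polyC; exact: dG.
have := jetG j; rewrite E mmapC => /rdvdXnP/(_ 0%N isT); rewrite coefC /= => ->.
exact: mpolyC0.
Qed.

End Edge.

Lemma linear_one_variable (k : fieldType) (p : {mpoly k[1]}) : dle 1 p ->
  p = (p@_0%MM)%:MP + p@_(U_(ord0))%MM *: 'X_ord0.
Proof.
move=> dp; apply/mpolyP => m; rewrite mcoeffD mcoeffC mcoeffZ mcoeffX.
have mE : mdeg m = m ord0 by rewrite mdegE big_ord1.
have [m0|m0] := eqVneq m 0%MM.
  by rewrite m0 (negPf (_ : U_(ord0)%MM != 0%MM)) ?eqxx ?mulr1 ?mulr0 ?addr0 // mnm1_eq0.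
have [m1|m1] := eqVneq U_(ord0)%MM m; first by rewrite m1 mulr0 mulr1 add0r.
rewrite !mulr0 addr0; apply: memN_msupp_eq0; apply: msize_mdeg_ge.
apply: leq_trans dp _; rewrite mE.
case E : (m ord0) => [|[|//]].
  by case/eqP: m0; apply/mnmP => i; rewrite (ord1 i) mnm0E; apply: E.
by case/eqP: m1; apply/mnmP => i; rewrite (ord1 i) mnm1E; apply/esym/E.
Qed.

(** A nonzero equation [a + b x = 0] modulo ['X^2] forces the jet to be constant to first order. Its
    value at 0 is then a stationary point. *)
Lemma line_consistent (k : fieldType) N n s (sigma : 'I_n -> 'I_N)
    (F : 'I_n -> {mpoly k[N]}) (G : 'I_s -> {mpoly k[N]}) (z : 'I_N -> {poly k}) :
  N = 1%N -> injective sigma -> (forall j, dle 1 (G j)) ->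
  (forall i, rdvd 'X^2 ((z (sigma i))^`() - mmap polyC z (F i))) ->
  (forall j, rdvd 'X^2 (mmap polyC z (G j))) -> consistent sigma F G.
Proof.
move=> N1; move: N1 sigma F G z => -> sigma F G z sinj dG jetF jetG.
have [G0|] := boolp.EM (forall j, G j = 0); first exact: unconstrained_consistent.
move/boolp.existsNP => [j /eqP Gj].
have := jetG j; rewrite {1}(linear_one_variable (dG j)) mmapD mmapC mmapZ mmapX mmap1U.
set a := _@__; set b := _@__ => /rdvdXnP h.
have h1 : b * (z ord0)`_1 = 0.
  by have := h 1%N isT; rewrite coefD coefC coefCM add0r.
have h0 : a + b * (z ord0)`_0 = 0.
  by have := h 0%N isT; rewrite coefD coefC coefCM.
(* If [b] were 0, the equation would give [a = 0] as well, and [G j] would vanish. *)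
have b0 : b != 0.
  apply: contraNneq Gj => b0; rewrite (linear_one_variable (dG j)) -/a -/b b0 scale0r addr0.
  by move: h0; rewrite b0 mul0r addr0 => ->.
have z1 : (z ord0)`_1 = 0 by move/eqP: h1; rewrite mulf_eq0 (negPf b0) => /eqP.
apply: (@stationary_consistent _ _ _ _ _ _ _ (fun i => (z i)`_0)) => [i|j'].
  have /rdvdXnP/(_ 0%N isT) := jetF i.
  rewrite coefB coef_deriv mulr1n ord1 z1 sub0r mmap_coef0 => /eqP.
  by rewrite oppr_eq0 => /eqP.
by rewrite -mmap_coef0; have /rdvdXnP/(_ 0%N isT) := jetG j'.
Qed.

Lemma no_variables (k : fieldType) N (p : {mpoly k[N]}) : N = 0%N -> dle 0 p.
Proof. by move=> N0; rewrite /dle (nvar0_mpolyC_eq p N0) msizeC leq_b1. Qed.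

End EdgeCases.

(** * Numerical bounds *)

Section Bounds.

Lemma jet_order_gt0 N D : (0 < CoreTheorem.jet_order N D)%N.
Proof.
by rewrite /CoreTheorem.jet_order muln_gt0 expn_gt0 muln_gt0 /Gap.gapE addn1.
Qed.

Variables N D : nat.
Let a := (N * D)%N.
Hypothesis a2 : (1 < a)%N.

(** The factors [N + 3], [(D + 2) N] and 2 of [minor_deg] are at most [a^3], [a^3] and [a]. Squaring
    gives [a^14], and the outer 2 one more [a]. *)
Lemma next_level_bound e : (CoreTheorem.next_level N D e <= a ^ 15 * e ^ 2)%N.
Proof.
have N0 : (0 < N)%N by move: a2; rewrite /a; case: (N).
have D0 : (0 < D)%N by move: a2; rewrite /a; case: (D) => //; rewrite muln0.
have Na : (N <= a)%N by rewrite leq_pmulr.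
have h1 : (N + 3 <= a ^ 3)%N.
  by apply: (@leq_trans (a * 4)); [lia|rewrite (expnD a 1 2) leq_mul2l (leq_sqr 2) a2 orbT].
have h2 : ((D + 2) * N <= a ^ 3)%N.
  apply: (@leq_trans (a * 4)); first by rewrite /a; nia.
  by rewrite (expnD a 1 2) leq_mul2l (leq_sqr 2) a2 orbT.
have h : (CoreTheorem.minor_deg N D e <= a ^ 7 * e)%N.
  rewrite /CoreTheorem.minor_deg (mulnA (D + 2)) (expnD a 3 4) -(mulnA (a ^ 3)%N) leq_mul //.
  by rewrite (expnD a 3 1) -(mulnA (a ^ 3)%N) leq_mul // leq_mul2r a2 orbT.
rewrite /CoreTheorem.next_level (expnD a 1 14) (expnM a 7 2) -mulnA -expnMn.
by rewrite leq_mul // leq_exp2r.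
Qed.

(** Multiplying by [a ^ 15] turns the recurrence into repeated squaring. *)
Lemma level_bound i : (CoreTheorem.level N D i * a ^ 15 <= a ^ (15 * 2 ^ i))%N.
Proof.
elim: i => [|i IH]; first by rewrite /= mul1n.
apply: (@leq_trans ((CoreTheorem.level N D i * a ^ 15) ^ 2)).
  rewrite expnMn -(mulnn (a ^ 15)) mulnA leq_mul2r mulnC; apply/orP; right.
  exact: next_level_bound.
by rewrite (expnSr 2 i) mulnA (expnM a _ 2) leq_exp2r.
Qed.

Lemma jet_order_bound : (CoreTheorem.jet_order N D <= a ^ (2 ^ (9 * N)))%N.
Proof.
have N0 : (0 < N)%N by move: a2; rewrite /a; case: (N).
have D0 : (0 < D)%N by move: a2; rewrite /a; case: (D) => //; rewrite muln0.
have Na : (N <= a)%N by rewrite leq_pmulr.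
have a0 : (0 < a)%N by apply: ltnW.
set d := CoreTheorem.level N D N.+1; set q := (15 * 2 ^ N.+1)%N.
have dq : (N.+1 * d <= a ^ (q + 2))%N.
  rewrite addnC expnD leq_mul //; first by rewrite -mulnn; nia.
  by apply: leq_trans (level_bound _); rewrite leq_pmulr // expn_gt0 a0.
have gq : (2 * Gap.gapE N d <= a ^ (2 + (q + 2) * N))%N.
  apply: (@leq_trans (2 * (2 * a ^ ((q + 2) * N)))).
    rewrite leq_mul2l /= /Gap.gapE mul2n -addnn leq_add ?expn_gt0 ?a0 //.
    by rewrite expnM leq_exp2r.
  by rewrite mulnA expnD leq_mul2r (leq_sqr 2) a2 orbT.
apply: (@leq_trans (a ^ (1 + (2 + (q + 2) * N) * N))).
  rewrite /CoreTheorem.jet_order expnD expn1 leq_mul // (expnM a) leq_exp2r //.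
(* With [t = 2 ^ N], the exponent [1 + (2 + (30 t + 2) N) N] is at most [64 t^3], hence at most
   [t^9]. *)
rewrite leq_pexp2l // (mulnC 9) (expnM 2 N) /q expnS.
have Nt : (N < 2 ^ N)%N by exact: ltn_expl.
set t := (2 ^ N)%N in Nt *.
have t2 : (1 < t)%N by apply: leq_trans Nt.
have h6 : (64 <= t ^ 6)%N by rewrite (@leq_exp2r 2 t 6).
have N2 : (N * N <= t ^ 2)%N by rewrite -mulnn leq_mul // ltnW.
have t23 : (2 * t ^ 2 <= t ^ 3)%N by rewrite (expnS t 2) leq_mul2r t2 orbT.
rewrite (expnD t 3 6); apply: (@leq_trans (t ^ 3 * 64)); last by rewrite leq_mul2l h6 orbT.
have NtN : (t * (N * N) <= t ^ 3)%N by rewrite (expnS t 2) leq_mul2l N2 orbT.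
have NN : (N <= N * N)%N by rewrite leq_pmulr.
have : (1 <= t ^ 3)%N by rewrite expn_gt0 ltnW.
nia.
Qed.

End Bounds.

Lemma INR_expn (a k : nat) : Raxioms.INR (a ^ k)%N = Rpow_def.pow (Raxioms.INR a) k.
Proof. by elim: k => // k IH; rewrite expnS RIneq.mult_INR IH. Qed.

(** As [maxn 1 r] is at least 1, the inner exponent in [bound] is at least [9 * (n + m)]. *)
Lemma nat_le_bound (n m D r L : nat) : (0 < (n + m) * D)%N ->
  (L <= ((n + m) * D) ^ (2 ^ (9 * (n + m))))%N ->
  Rdefinitions.Rle (Raxioms.INR L) (bound (Raxioms.INR 9) n m D r).
Proof.
set a := ((n + m) * D)%N => a0 La.
have a1 : Rdefinitions.Rle Rdefinitions.R1 (Raxioms.INR a) by apply: (RIneq.le_INR 1); apply/leP.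
have apos : Rdefinitions.Rlt Rdefinitions.R0 (Raxioms.INR a).
  exact: RIneq.Rlt_le_trans RIneq.Rlt_0_1 a1.
rewrite /bound /rpow -/a; case: RIneq.Rle_dec => [le0|gt0].
  by case: (RIneq.Rle_not_lt _ _ le0 apos).
apply: (RIneq.Rle_trans _ (Raxioms.INR (a ^ (2 ^ (9 * (n + m))))%N)).
  exact/RIneq.le_INR/leP.
rewrite INR_expn -Rpower.Rpower_pow //; apply: Rpower.Rle_Rpower => //.
rewrite INR_expn -Rpower.Rpower_pow; last exact: RIneq.Rlt_0_2.
apply: Rpower.Rle_Rpower; first by left; exact: RIneq.Rlt_plus_1.
rewrite -RIneq.mult_INR; apply/RIneq.le_INR/leP.
by rewrite leq_mul2l /= leq_pmull // expn_gt0 leq_max.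
Qed.

Theorem theorem4p1 :
  exists c : RR, Rdefinitions.Rlt Rdefinitions.R0 c /\
  forall (n m s : nat) (f : 'I_n -> OPoly (n + m)%N) (g : 'I_s -> OPoly (n + m)%N)
         (d : DPoly (n + m)%N -> DPoly (n + m)%N) (r D : nat),
    total_derivation d ->
    (exists z, vzeros g z) ->
    dim_is (vzeros g) r ->
    (forall i, (msize (f i) <= D.+1)%N) ->
    (forall j, (msize (g j) <= D.+1)%N) ->
    (exists degV, deg_is (vzeros g) degV /\ (degV <= D)%N) ->
    exists L : nat,
      Rdefinitions.Rle (Raxioms.INR L) (bound c n m D r) /\
      (in_diff_ideal d (@sys_gens n m s f g) 1%R <-> in_ideal (@trunc_gens n m s d f g L) 1%R).
Proof.
(* The constant 9 is the one in the exponent of [jet_order_bound]. *)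
exists (Raxioms.INR 9); split; first exact: (RIneq.lt_INR 0 9 (@ltP 0 9 isT)).
move=> n m s f g d r D dP _ _ sf sg _.
have [a0|a1|a1] := ltngtP ((n + m) * D) 1.
(* The default value of [rpow] at base 0 makes the bound 0, forcing [L = 0]. All the [g j] are
   constants here, so jets modulo ['X] suffice. *)
- move: a0; rewrite ltnS leqn0 => /eqP a0; exists 0%N; split.
    rewrite /bound a0 /rpow; case: RIneq.Rle_dec => [le0|h]; first exact: RIneq.Rle_refl.
    by case: h; exact: RIneq.Rle_refl.
  apply: DiffRing.jets_decide => // K c z ch0 _ jetG.
  apply: EdgeCases.constant_consistent jetG; first exact: lshift_inj.
  move=> j; have [N0|D0] : (n + m = 0)%N \/ D = 0%N.
    by move/eqP: a0; rewrite muln_eq0 => /orP[/eqP|/eqP]; [left|right].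
  + exact: EdgeCases.no_variables.
  + by have := sg j; rewrite D0 => /(Conversion.dle_conv c).
(* Truncation at [L] corresponds to jets modulo ['X^(L.+1)], whence the predecessor. *)
- exists (CoreTheorem.jet_order (n + m) D).-1; split.
    apply: nat_le_bound; first exact: ltnW.
    by apply: leq_trans (leq_pred _) _; exact: jet_order_bound.
  apply: DiffRing.jets_decide => // K c z ch0; rewrite prednK ?jet_order_gt0 //.
  move=> jetF jetG; apply: (CoreTheorem.jet_consistent ch0 _ _ _ _ jetF jetG).
  + exact: lshift_inj.
  + by move: a1; case: (n + m)%N.
  + by move=> i; exact: Conversion.dle_conv.
  + by move=> j; exact: Conversion.dle_conv.
(* With base 1 the bound is 1, so [L = 1] and jets modulo ['X^2] must decide; there is one variable
   and the equations are linear. *)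
- exists 1%N; split.
    by apply: nat_le_bound; rewrite a1 // exp1n.
  have [N1 D1] : (n + m = 1)%N /\ D = 1%N.
    by move/eqP: a1; rewrite muln_eq1 => /andP[/eqP-> /eqP->].
  apply: DiffRing.jets_decide => // K c z ch0.
  apply: EdgeCases.line_consistent; [exact: N1|exact: lshift_inj|].
  by move=> j; have := sg j; rewrite D1 => /(Conversion.dle_conv c).
Qed.
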